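(* Let $R$ be a commutative ring with unit, and let $\bar p$ and $\bar q$ be perversities on a poset $P$. For any couple of integers $(n,m)$, there is an isomorphism $$\mathrm{Nat}_R(\mathscr H^n_{\bar p},\mathscr H^m_{\bar q})\;\cong\;\mathscr H^m_{\bar q}\big(\mathtt K(R,n,P,\bar p);R\big),$$ where $\mathrm{Nat}_R(\mathscr H^n_{\bar p},\mathscr H^m_{\bar q})$ is the set of perverse cohomological operations of type $(\bar p,n,\bar q,m)$, i.e. of natural transformations between the functors $\mathscr H^n_{\bar p}(-;R)$ and $\mathscr H^m_{\bar q}(-;R)$ from $\mathrm{Sset}_P$ to the category of $R$-modules.
   Context: **Simplicial sets over $P$.** $N(P)$ is the nerve of $P$. An object of $\mathrm{Sset}_P$ is a simplicial map $\Psi_L\colon L\to N(P)$; morphisms are simplicial maps over $N(P)$. Equivalently it is a presheaf on the category $\Delta[P]$ of simplices of $N(P)$ (objects: simplicial maps $\sigma\colon\Delta[k]\to N(P)$; morphisms: simplicial maps over $N(P)$). **Perversities.** A perversity on $P$ is a map $\bar p\colon P\to\mathbb Z\cup\{\pm\infty\}$ equal to $0$ on maximal elements. **Blown-up cochains.** $N^*(-)$ denotes normalized simplicial cochains with coefficients in $R$. A simplex $\sigma$ of $N(P)$ is written $s_0^{[q_0]}\prec\dots\prec s_\ell^{[q_\ell]}$ ($s_i$ repeated $q_i+1$ times, $q_i\ge 0$), giving $\Delta[k]=\Delta[q_0]*\dots*\Delta[q_\ell]$; it is regular if $s_\ell$ is maximal in $P$. Let $c\Delta[q]$ be the cone on $\Delta[q]$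 with apex $v$ as last vertex, $c\emptyset=\{v\}$. For regular $\sigma$, $\widetilde N^*(\sigma)=N^*(c\Delta[q_0])\otimes\dots\otimes N^*(c\Delta[q_{\ell-1}])\otimes N^*(\Delta[q_\ell])$. It has the basis $\mathbf 1_{(F,\varepsilon)}=\mathbf 1_{(F_0,\varepsilon_0)}\otimes\dots\otimes\mathbf 1_{(F_{\ell-1},\varepsilon_{\ell-1})}\otimes\mathbf 1_{F_\ell}$, where for $i<\ell$, $(F_i,0)$ is a non-empty face $F_i$ of $\Delta[q_i]$, $(F_i,1)$ is the cone $cF_i$ with $F_i$ a possibly empty face, and $F_\ell$ is a face of $\Delta[q_\ell]$. For $s\in P$ the perverse degree $\|\mathbf 1_{(F,\varepsilon)}\|_s$ is $\dim\big((F_{i+1},\varepsilon_{i+1})\times\dots\times F_\ell\big)$ if $s=s_i$ with $i<\ell$ and $\varepsilon_i=0$; it is $0$ if $s=s_\ell$ (empty product); it is $-\infty$ otherwise. For a linear combination with non-zero coefficients take the maximum; $\|0\|_s=-\infty$. A cochain $\omega$ is $\bar p$-allowable if $\|\omega\|_s\le\bar p(s)$ for all $s$; $\widetilde N^*_{\bar p}(\sigma)$ is the complex of those $\omega$ such that $\omega$ and $\delta\omega$ are $\bar p$-allowable. Put $\widetilde N_{\bar p}^*(\sigma)=0$ for non-regular $\sigma$. For a morphism $\alpha\colon\sigma\to\tau$ of regular simplices over $N(P)$, $\alpha^*\colon\widetilde N^*(\tau)\to\widetilde N^*(\sigma)$ is the tensor product of the restrictions along the (coned) maps between the blocks over the same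 element of $P$, and, for a block of $\tau$ over an element not occurring in $\sigma$, of the restriction $N^*(c\Delta[q])\to N^*(\{v\})=R$; this preserves $\widetilde N^*_{\bar p}$, so $\sigma\mapsto\widetilde N^k_{\bar p}(\sigma)$ is a presheaf on $\Delta[P]$. For $\Psi_L\in\mathrm{Sset}_P$, $\widetilde N^k_{\bar p}(\Psi_L)=\mathrm{Hom}_{\mathrm{Sset}_P}(\Psi_L,\widetilde N^k_{\bar p}(\bullet))$, and $\mathscr H^*_{\bar p}(\Psi_L;R)$ is the cohomology of the complex $\widetilde N^*_{\bar p}(\Psi_L)$ (which is zero in negative degrees). The functors $\mathscr H^k_{\bar p}(-;R)$ are contravariant. **Perverse Eilenberg–MacLane spaces.** $\mathtt K(R,n,P,\bar p)\in\mathrm{Sset}_P$ is the presheaf on $\Delta[P]$ sending $\sigma$ to the set $\mathcal Z^n\widetilde N^*_{\bar p}(\sigma)$ of degree $n$ cocycles.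
   Formalization: Natural transformations are taken between the underlying set-valued functors, components not assumed R-linear; with R-linear components the claim fails (P a point, R = Z, (n,m) = (2,4): cup square). The isomorphism is R-linear for the pointwise structure. *)

(* Defs.v *)
From HB Require Import structures.
From mathcomp Require Import all_boot all_order all_algebra.
From mathcomp Require Export finmap.
From mathcomp Require Import boolp constructive_ereal.

Set Implicit Arguments.
Unset Strict Implicit.
Unset Printing Implicit Defensive.

Import Order.TTheory GRing.Theory Num.Theory.

Local Open Scope ring_scope.

(* MathComp provides the quotient of a zmodType only. *)
Section QuotientModule.
Local Open Scope quotient_scope.
Variables (R : pzRingType) (V : lmodType R) (I : submodClosed V).

Definition lquot_pred : {pred V} := I.
HB.instance Definition _ := GRing.isZmodClosed.Build V lquot_pred
  (GRing.submod_closedB (submodClosedP I)).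

Definition lquot : Type := Quotient.quot lquot_pred.
HB.instance Definition _ := Choice.on lquot.
HB.instance Definition _ := GRing.Zmodule.on lquot.

Definition lclass (v : V) : lquot := \pi_(Quotient.quot lquot_pred) v.
Definition lrepr (x : lquot) : V := repr (x : Quotient.quot lquot_pred).
Definition lquot_scale (r : R) (x : lquot) : lquot := lclass (r *: lrepr x).

Lemma lreprK x : lclass (lrepr x) = x.
Proof. exact: reprK. Qed.

Lemma lclass_eq v w : lclass v = lclass w <-> v - w \in I.
Proof.
by rewrite -[v - w \in I]/(v - w \in lquot_pred) Quotient.idealrBE; split=> /eqP.
Qed.

Lemma lclassD : {morph lclass : v w / v + w}.
Proof. exact: (raddfD \pi_(Quotient.quot lquot_pred)). Qed.

Lemma lclass_scale r v : lclass (r *: v) = lquot_scale r (lclass v).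
Proof.
apply/lclass_eq; rewrite -scalerBr; apply: rpredZ.
by apply/lclass_eq; rewrite lreprK.
Qed.

Fact lquot_scaleA r s x : lquot_scale r (lquot_scale s x) = lquot_scale (r * s) x.
Proof. by rewrite -(lreprK x) -!lclass_scale scalerA. Qed.
Fact lquot_scale1 : left_id 1 lquot_scale.
Proof. by move=> x; rewrite -(lreprK x) -lclass_scale scale1r. Qed.
Fact lquot_scaleDr : right_distributive lquot_scale +%R.
Proof.
move=> r x y; rewrite -(lreprK x) -(lreprK y).
by rewrite -lclassD -!lclass_scale scalerDr lclassD.
Qed.
Fact lquot_scaleDl x : {morph lquot_scale^~ x : r s / r + s}.
Proof. by move=> r s; rewrite -(lreprK x) -!lclass_scale scalerDl lclassD. Qed.

HB.instance Definition _ := GRing.Zmodule_isLmodule.Build R lquot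
  lquot_scaleA lquot_scale1 lquot_scaleDr lquot_scaleDl.

Fact lclass_is_linear : linear lclass.
Proof. by move=> r v w; rewrite lclassD lclass_scale. Qed.
HB.instance Definition _ := GRing.isLinear.Build R V lquot _ lclass lclass_is_linear.

End QuotientModule.

Definition chain (d : Order.disp_t) (T : porderType d) (k : nat) :=
  {f : {ffun 'I_k.+1 -> T} |
    [forall i : 'I_k.+1, forall j : 'I_k.+1, (i <= j)%N ==> (f i <= f j)%O]}.

Definition chain_fun (d : Order.disp_t) (T : porderType d) k (s : chain T k) :
  'I_k.+1 -> T := val s.

Coercion chain_fun : chain >-> Funclass.

(* Morphisms [j] -> [k] of the simplex category. *)
Notation simplex_map j k := (chain 'I_k.+1 j).

Lemma chain_le (d : Order.disp_t) (T : porderType d) k (s : chain T k)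
  (i j : 'I_k.+1) : (i <= j)%N -> (s i <= s j)%O.
Proof. by have /forallP/(_ i)/forallP/(_ j)/implyP := valP s. Qed.

Lemma chain_ext (d : Order.disp_t) (T : porderType d) k (s t : chain T k) :
  (forall i, s i = t i) -> s = t.
Proof. by move=> st; apply/val_inj/ffunP. Qed.

Fact chain_comp_subproof (d : Order.disp_t) (T : porderType d) j k
    (t : chain T k) (a : simplex_map j k) :
  [forall i : 'I_j.+1, forall i' : 'I_j.+1, (i <= i')%N ==>
     ([ffun l => t (a l)] i <= [ffun l => t (a l)] i')%O].
Proof.
apply/forallP => i; apply/forallP => i'; apply/implyP => le_ii'.
rewrite !ffunE; apply: chain_le.
by have := chain_le a le_ii'; rewrite leEord.
Qed.

Definition chain_comp (d : Order.disp_t) (T : porderType d) j k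
    (t : chain T k) (a : simplex_map j k) : chain T j :=
  exist _ [ffun l => t (a l)] (chain_comp_subproof t a).

Lemma chain_compE (d : Order.disp_t) (T : porderType d) j k
  (t : chain T k) (a : simplex_map j k) i : chain_comp t a i = t (a i).
Proof. by rewrite /chain_comp /chain_fun /= ffunE. Qed.

Lemma chain_compA (d : Order.disp_t) (T : porderType d) i j k
  (t : chain T k) (a : simplex_map j k) (b : simplex_map i j) :
  chain_comp t (chain_comp a b) = chain_comp (chain_comp t a) b.
Proof. by apply: chain_ext => l; rewrite !chain_compE. Qed.

Fact simplex_id_subproof k :
  [forall i : 'I_k.+1, forall j : 'I_k.+1, (i <= j)%N ==>
     ([ffun l : 'I_k.+1 => l] i <= [ffun l : 'I_k.+1 => l] j)%O].
Proof.
by apply/forallP => i; apply/forallP => j; apply/implyP; rewrite !ffunE leEord.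
Qed.

Definition simplex_id k : simplex_map k k :=
  exist _ [ffun l => l] (simplex_id_subproof k).

Lemma simplex_idE k i : simplex_id k i = i.
Proof. by rewrite /simplex_id /chain_fun /= ffunE. Qed.

Lemma chain_compx1 (d : Order.disp_t) (T : porderType d) k (t : chain T k) :
  chain_comp t (simplex_id k) = t.
Proof. by apply: chain_ext => l; rewrite chain_compE simplex_idE. Qed.

Record sset := Sset {
  sset_obj :> nat -> Type;
  sset_act : forall j k, simplex_map j k -> sset_obj k -> sset_obj j;
  sset_act1 : forall k (x : sset_obj k), sset_act (simplex_id k) x = x;
  sset_actM : forall i j k (a : simplex_map j k) (b : simplex_map i j)
    (x : sset_obj k), sset_act (chain_comp a b) x = sset_act b (sset_act a x) }.

Arguments sset_act : clear implicits.
Arguments sset_act _ {j k} _ _.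

Record sset_map (K L : sset) := SsetMap {
  smap_fun :> forall k, K k -> L k;
  smap_nat : forall j k (a : simplex_map j k) (x : K k),
    smap_fun (sset_act K a x) = sset_act L a (smap_fun x) }.

Arguments smap_fun {K L} _ k _.

Section Poset.
Variables (d : Order.disp_t) (P : porderType d).

Definition nerve : sset :=
  @Sset (chain P) (fun j k a s => chain_comp s a) (@chain_compx1 _ P)
    (fun i j k a b s => chain_compA s a b).

Record ssetP := SsetP { ssetP_tot :> sset; ssetP_proj : sset_map ssetP_tot nerve }.

Definition supp (L : ssetP) k (x : L k) : chain P k := ssetP_proj L k x.

Lemma supp_act (L : ssetP) j k (a : simplex_map j k) (x : L k) :
  supp (sset_act L a x) = chain_comp (supp x) a.
Proof. exact: (smap_nat (ssetP_proj L)). Qed.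

Record ssetP_map (K L : ssetP) := SsetPMap {
  spmap :> sset_map K L;
  spmap_proj : forall k (x : K k), supp (spmap k x) = supp x }.

Definition maximal (s : P) : Prop := forall t : P, (s <= t)%O -> t = s.

Record perversity := Perversity {
  perv :> P -> \bar int;
  perv_max : forall s, maximal s -> perv s = 0%E }.

(* A cell (F, E) of a k-simplex stands for the basis element 1_(F,eps): F is *)
(* the union of the faces F_i of the blocks (so F_i = F :&: sigma^-1(s_i))    *)
(* and E is the set of those s_i with eps_i = 1.                              *)
Definition cell (k : nat) := ({set 'I_k.+1} * {fset P})%type.

Section Cells.
Variables (k : nat) (sigma : chain P k).

Definition regular : bool := `[< maximal (sigma ord_max) >].

Definition blocks : {fset P} := [fset sigma i | i in 'I_k.+1]%fset.

Definition block_face (c : cell k) (s : P) : {set 'I_k.+1} :=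
  [set i in c.1 | sigma i == s].

(* Nonregular simplices have no cells; a block that is not coned must meet F. *)
Definition is_cell (c : cell k) : bool :=
  [&& regular, (c.2 `<=` blocks `\ sigma ord_max)%fset &
      [forall i, (sigma i \in c.2) || (block_face c (sigma i) != set0)]].

Definition cells : seq (cell k) :=
  [seq c <- [seq (F, E) | F : {set 'I_k.+1} <- enum {set 'I_k.+1},
                          E <- enum_fset (fpowerset (blocks `\ sigma ord_max)%fset)]
         | is_cell c].

(* Dimension of the factor (F_i, eps_i) for s = s_i: the vertices are those of *)
(* F_i, and the apex if eps_i = 1.                                            *)
Definition factor_dim (c : cell k) (s : P) : nat :=
  (#|block_face c s| + (s \in c.2)).-1.

Definition cell_dim (c : cell k) : nat := (\sum_(s <- blocks) factor_dim c s)%N.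

Definition perverse_degree (c : cell k) (s : P) : \bar int :=
  if s == sigma ord_max then 0%E
  else if (s \in blocks) && (s \notin c.2) then
    ((\sum_(t <- blocks | (s < t)%O) factor_dim c t)%N%:Z)%:E
  else -oo%E.

End Cells.

Section Cochains.
Variable R : comPzRingType.

(* Coordinates of a blown-up cochain in the basis of cells; only the           *)
(* functions vanishing outside the cells of sigma are cochains on sigma.       *)
Definition cochain (k : nat) := cell k -> R.

Definition cochain_norm k (sigma : chain P k) (w : cochain k) (s : P) : \bar int :=
  \big[Order.max/-oo%E]_(c <- cells sigma | w c != 0) perverse_degree sigma c s.

Definition allowable k (sigma : chain P k) (p : perversity) (w : cochain k) : Prop :=
  forall s, (cochain_norm sigma w s <= p s)%O.

Definition homogeneous k (sigma : chain P k) (n : int) (w : cochain k) : Prop :=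
  forall c, w c != 0 -> is_cell sigma c /\ (cell_dim sigma c)%:Z = n.

(* Position of a vertex in its factor plus the Koszul sign, i.e. the total      *)
(* dimension of the preceding factors.  The apex is the last vertex.           *)
Definition koszul k (sigma : chain P k) (c : cell k) (s : P) : nat :=
  (\sum_(t <- blocks sigma | (t < s)%O) factor_dim sigma c t)%N.

Definition vertex_sign k (sigma : chain P k) (c : cell k) (i : 'I_k.+1) : R :=
  (-1) ^+ (koszul sigma c (sigma i)
           + #|[set j in block_face sigma c (sigma i) | (j < i)%N]|)%N.

Definition apex_sign k (sigma : chain P k) (c : cell k) (s : P) : R :=
  (-1) ^+ (koszul sigma c s + #|block_face sigma c s|)%N.

(* The differential of the tensor product, as the transpose of the boundary of *)
(* the product of simplices.  A factor reduced to one vertex contributes 0,     *)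
(* since deleting this vertex gives a pair that is not a cell.                  *)
Definition coboundary k (sigma : chain P k) (w : cochain k) : cochain k :=
  fun c => if is_cell sigma c then
      \sum_(i in c.1) vertex_sign sigma c i * w (c.1 :\ i, c.2)
    + \sum_(s <- c.2) apex_sign sigma c s * w (c.1, (c.2 `\ s)%fset)
  else 0.

(* The image of a cell of tau \o a: the blocks of tau not met by a contribute  *)
(* their apex (empty face, eps = 1).                                           *)
Definition push_cell j k (tau : chain P k) (a : simplex_map j k) (c : cell j) :
  cell k :=
  (a @: c.1, (c.2 `|` (blocks tau `\` blocks (chain_comp tau a)))%fset).

(* Degenerate images are killed in normalized cochains.                        *)
Definition pull j k (tau : chain P k) (a : simplex_map j k) (w : cochain k) :
  cochain j :=
  fun c => if is_cell (chain_comp tau a) c && dinjectiveb a (mem c.1)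
           then w (push_cell tau a c) else 0.

Definition blownup k (sigma : chain P k) (p : perversity) (n : int)
    (w : cochain k) : Prop :=
  [/\ homogeneous sigma n w, allowable sigma p w &
      allowable sigma p (coboundary sigma w)].

Definition blownup_cocycle k (sigma : chain P k) (p : perversity) (n : int)
    (w : cochain k) : Prop :=
  blownup sigma p n w /\ coboundary sigma w = fun=> 0.


Lemma mem_blocks k (sigma : chain P k) s :
  reflect (exists i, s = sigma i) (s \in blocks sigma).
Proof.
apply: (iffP (imfsetP _ _ _ _)) => [[i _ ->]|[i ->]]; first by exists i.
by exists i.
Qed.

Lemma blocks_in k (sigma : chain P k) i : sigma i \in blocks sigma.
Proof. by apply/mem_blocks; exists i. Qed.

Lemma mem_cells k (sigma : chain P k) c : (c \in cells sigma) = is_cell sigma c.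
Proof.
rewrite mem_filter; apply: andb_idr => /and3P[_ cE _].
case: c cE => F E /= cE; apply/allpairsPdep; exists F, E; split => //.
  by rewrite mem_enum.
by rewrite fpowersetE.
Qed.

Lemma allowableP k (sigma : chain P k) (p : perversity) (w : cochain k) :
  allowable sigma p w <-> forall c s, is_cell sigma c -> w c != 0 ->
    (perverse_degree sigma c s <= p s)%O.
Proof.
split=> [H c s cC wc|H s].
  apply: le_trans (H s).
  apply: (le_bigmax_seq _ _ _ (fun c' => perverse_degree sigma c' s)) => //.
  by rewrite mem_cells.
rewrite /cochain_norm big_seq_cond; apply: bigmax_le; first exact: leNye.
by move=> c /andP[]; rewrite mem_cells; exact: H.
Qed.

Section Push.
Variables (j k : nat) (tau : chain P k) (a : simplex_map j k).
Local Notation sigma := (chain_comp tau a).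

Lemma blocks_sub : (blocks sigma `<=` blocks tau)%fset.
Proof.
by apply/fsubsetP => s /mem_blocks[i ->]; rewrite chain_compE blocks_in.
Qed.

Lemma regular_last : regular sigma -> tau ord_max = sigma ord_max.
Proof.
move=> /asboolP; apply; rewrite chain_compE; apply: chain_le.
by rewrite -ltnS ltn_ord.
Qed.

Lemma regular_pull : regular sigma -> regular tau.
Proof. by move=> rs; rewrite /regular regular_last. Qed.

Lemma block_push c s :
  block_face tau (push_cell tau a c) s = a @: block_face sigma c s.
Proof.
apply/setP => y; rewrite inE; apply/andP/imsetP => [[/imsetP[i iF ->] ys]|].
  by exists i => //; rewrite inE iF chain_compE.
by case=> i; rewrite inE chain_compE => /andP[iF si] ->; rewrite imset_f.
Qed.

Lemma push_cell_conv c : regular sigma ->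
  (c.2 `<=` blocks sigma `\ sigma ord_max)%fset ->
  is_cell tau (push_cell tau a c) -> is_cell sigma c.
Proof.
move=> rs cE /and3P[_ _ /forallP H]; apply/and3P; split=> //.
apply/forallP => i; have := H (a i); rewrite -chain_compE block_push.
case/orP => [|]; last by rewrite imset_eq0 => ->; rewrite orbT.
by rewrite !inE blocks_in /= orbF => ->.
Qed.

Section InjPush.
Variable c : cell j.
Hypotheses (cC : is_cell sigma c) (ca : {in c.1 &, injective a}).

Lemma card_block_push s :
  #|block_face tau (push_cell tau a c) s| = #|block_face sigma c s|.
Proof.
rewrite block_push card_in_imset // => x y; rewrite !inE => /andP[xF _] /andP[yF _].
exact: ca.
Qed.

Lemma cell_sub s : s \in c.2 -> s \in blocks sigma.
Proof.
by case/and3P: cC => _ /fsubsetP H _ /H; rewrite !inE => /andP[].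
Qed.

Lemma factor_dim_out s : s \notin blocks sigma -> factor_dim sigma c s = 0%N.
Proof.
move=> sN; rewrite /factor_dim (_ : block_face _ _ _ = set0).
  by rewrite cards0 (negbTE (contra (@cell_sub s) sN)).
apply/setP => i; rewrite !inE; apply/negbTE; apply: contra sN => /andP[_ /eqP <-].
exact: blocks_in.
Qed.

Lemma factor_dim_push s :
  factor_dim tau (push_cell tau a c) s = factor_dim sigma c s.
Proof.
case: (boolP (s \in blocks sigma)) => sB.
  by rewrite /factor_dim card_block_push !inE sB /= orbF.
rewrite factor_dim_out // /factor_dim card_block_push.
rewrite (_ : block_face _ _ _ = set0) ?cards0; first by case: (_ \in _).
apply/setP => i; rewrite !inE; apply/negbTE; apply: contra sB => /andP[_ /eqP <-].
exact: blocks_in.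
Qed.

Lemma sum_dim_push (Q : pred P) :
  (\sum_(t <- blocks tau | Q t) factor_dim tau (push_cell tau a c) t =
   \sum_(t <- blocks sigma | Q t) factor_dim sigma c t)%N.
Proof.
rewrite big_mkcond [RHS]big_mkcond /=.
under eq_bigr do rewrite factor_dim_push.
symmetry; apply: big_fset_incl => [|s _ sN]; first exact: blocks_sub.
by rewrite factor_dim_out // if_same.
Qed.

Lemma push_cellP : is_cell tau (push_cell tau a c).
Proof.
have /and3P[rs /fsubsetP cE /forallP H] := cC; apply/and3P; split.
- exact: regular_pull.
- apply/fsubsetP => s; rewrite !inE regular_last // => /orP[/cE|/andP[sN sB]].
    by rewrite !inE => /andP[-> /(fsubsetP blocks_sub)].
  rewrite sB andbT; apply: contra sN => /eqP ->; exact: blocks_in.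
- apply/forallP => i; rewrite block_push !inE.
  case: (boolP (tau i \in blocks sigma)) => [/mem_blocks[l ->]|_]; last first.
    by rewrite blocks_in orbT.
  by rewrite /= orbF imset_eq0.
Qed.

Lemma perverse_degree_push s :
  perverse_degree tau (push_cell tau a c) s = perverse_degree sigma c s.
Proof.
have /and3P[rs _ _] := cC.
rewrite /perverse_degree regular_last // sum_dim_push !inE.
case: eqP => // _; case: (boolP (s \in blocks sigma)) => sB /=.
  by rewrite orbF (fsubsetP blocks_sub).
by case: (s \in blocks tau); rewrite //= orbT.
Qed.

Lemma vertex_sign_push i : i \in c.1 ->
  vertex_sign tau (push_cell tau a c) (a i) = vertex_sign sigma c i.
Proof.
move=> iF; congr (_ ^+ _); rewrite /koszul sum_dim_push -chain_compE; congr addn.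
rewrite block_push -[in RHS](card_in_imset (f := a)); last first.
  move=> x y; rewrite !inE => /andP[/andP[xF _] _] /andP[/andP[yF _] _]; exact: ca.
apply: eq_card => y; rewrite inE.
have mono l : l \in c.1 -> (a l < a i)%N = (l < i)%N.
  move=> lF; case: (ltngtP l i) => [li|il|/val_inj->]; last by rewrite ltnn.
    have := chain_le a (ltnW li); rewrite leEord leq_eqVlt => /orP[/eqP e|-> //].
    by move: li; rewrite (ca lF iF (val_inj e)) ltnn.
  have := chain_le a (ltnW il); rewrite leEord => le_il.
  by rewrite ltnNge le_il.
apply/andP/imsetP => [[/imsetP[l] + ->] lt|[l]].
  rewrite inE => /andP[lF sl]; exists l => //.
  by rewrite !inE lF sl -mono.
by rewrite !inE => /andP[/andP[lF sl] lt] ->; rewrite mono // imset_f // inE lF.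
Qed.

Lemma apex_sign_push s :
  apex_sign tau (push_cell tau a c) s = apex_sign sigma c s.
Proof. by rewrite /apex_sign /koszul sum_dim_push card_block_push. Qed.

End InjPush.
End Push.


Section Pull.
Variables (j k : nat) (tau : chain P k) (a : simplex_map j k) (w : cochain k).
Local Notation sigma := (chain_comp tau a).

Lemma pullE (c : cell j) : is_cell sigma c -> {in c.1 &, injective a} ->
  pull tau a w c = w (push_cell tau a c).
Proof. by move=> cC ca; rewrite /pull cC; case: dinjectiveP. Qed.

Lemma pull_eq0 (c : cell j) : ~ {in c.1 &, injective a} -> pull tau a w c = 0.
Proof. by move=> ca; rewrite /pull; case: dinjectiveP => // _; rewrite andbF. Qed.

Lemma pull_neq0 (c : cell j) : pull tau a w c != 0 ->
  [/\ is_cell sigma c, {in c.1 &, injective a} & w (push_cell tau a c) != 0].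
Proof.
rewrite /pull; case: (boolP (is_cell sigma c)) => cC /=; last by rewrite eqxx.
by case: dinjectiveP => //; rewrite eqxx.
Qed.

Lemma pull_supp (c : cell j) : pull tau a w c != 0 -> is_cell sigma c.
Proof. by case/pull_neq0. Qed.

Lemma homogeneous_pull n : homogeneous tau n w -> homogeneous sigma n (pull tau a w).
Proof.
move=> H c /pull_neq0[cC ca /H[_ <-]]; split=> //.
by rewrite /cell_dim (sum_dim_push cC ca predT).
Qed.

Lemma allowable_pull p : allowable tau p w -> allowable sigma p (pull tau a w).
Proof.
move=> /allowableP H; apply/allowableP => c s cC /pull_neq0[_ ca wc].
by rewrite -(perverse_degree_push cC ca); apply: H => //; apply: push_cellP.
Qed.

Hypothesis wC : forall c, w c != 0 -> is_cell tau c.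

Lemma pull_push (c : cell j) : regular sigma ->
  (c.2 `<=` blocks sigma `\ sigma ord_max)%fset -> {in c.1 &, injective a} ->
  pull tau a w c = w (push_cell tau a c).
Proof.
move=> rs cE ca; have [cC|cN] := boolP (is_cell sigma c); first exact: pullE.
rewrite /pull (negbTE cN) /=; apply/esym/eqP; apply: contraNT cN => /wC.
exact: push_cell_conv.
Qed.

Lemma pull_coboundary_inj (c : cell j) : {in c.1 &, injective a} ->
  pull tau a (coboundary tau w) c = coboundary sigma (pull tau a w) c.
Proof.
move=> ca; have [cC|cN] := boolP (is_cell sigma c); last first.
  by rewrite /pull /coboundary (negbTE cN).
have /and3P[rs cE /forallP cF] := cC.
rewrite [LHS]/pull cC; case: dinjectiveP => //= _.
rewrite /coboundary cC push_cellP //; congr (_ + _).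
  rewrite big_imset //=; apply: eq_bigr => i iF.
  rewrite vertex_sign_push //; congr (_ * _).
  rewrite pull_push //=; last by move=> x y /setD1P[_ xF] /setD1P[_ yF]; exact: ca.
  congr w; rewrite /push_cell /=; congr pair; apply/setP => y.
  rewrite !inE; apply/andP/imsetP => [[yi /imsetP[l lF e]]|[l]].
    exists l => //; rewrite !inE lF andbT; apply: contraNneq yi => li.
    by rewrite e li.
  rewrite !inE => /andP[li lF] ->; split; last exact: imset_f.
  by apply: contraNneq li => /ca ->.
have sM s : s \in c.2 -> s \in blocks sigma by exact: cell_sub.
symmetry; transitivity (\sum_(s <- c.2) apex_sign tau (push_cell tau a c) s *
  w (a @: c.1, ((push_cell tau a c).2 `\ s)%fset)).
  apply: eq_big_seq => s sE; rewrite apex_sign_push //; congr (_ * _).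
  rewrite pull_push //=; last exact: fsubset_trans (fsubD1set _ _) cE.
  congr w; rewrite /push_cell /=; congr pair; apply/fsetP => t.
  rewrite !inE; case: (eqVneq t s) => //= ->; by rewrite sM.
apply: big_fset_incl => [|s]; first exact: fsubsetUl.
rewrite !inE => + sN; rewrite (negbTE sN) /= => /andP[sB sT].
rewrite [w _](_ : _ = 0) ?mulr0 //; apply/eqP/negPn/negP => /wC.
case/and3P => _ _ /forallP; case/mem_blocks: sT sB => i -> sB.
move=> /(_ i); rewrite !inE eqxx /= => /set0Pn[l].
rewrite inE => /andP[/imsetP[l' _ ->] /eqP sl].
by move: sB; rewrite -sl -chain_compE blocks_in.
Qed.

End Pull.


Lemma pull_coboundary j k (tau : chain P k) (a : simplex_map j k) (w : cochain k) :
  (forall c, w c != 0 -> is_cell tau c) ->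
  pull tau a (coboundary tau w) = coboundary (chain_comp tau a) (pull tau a w).
Proof.
move=> wC; apply/funext => c; set sigma := chain_comp tau a.
case: (boolP (dinjectiveb a (mem c.1))) => [/dinjectiveP|caN].
  exact: pull_coboundary_inj.
rewrite pull_eq0; last by move=> ca; case/dinjectiveP: caN.
rewrite /coboundary; have [cC|//] := boolP (is_cell sigma c).
rewrite addrC big1 => [|s _]; last first.
  by rewrite pull_eq0 ?mulr0 //= => ca; case/dinjectiveP: caN.
rewrite add0r.
have [x [y [xF yF xy e]]] : exists x y : 'I_j.+1,
    [/\ x \in c.1, y \in c.1, (x < y)%N & a x = a y].
  case/dinjectivePn: caN => x xF [y /andP[/= nyx yF] e].
  case: (ltngtP x y) => [lt|lt|/val_inj exy]; [by exists x, y|by exists y, x|].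
  by rewrite exy eqxx in nyx.
have nyx : y != x by apply: contraTneq xy => ->; rewrite ltnn.
have nxy : x != y by rewrite eq_sym.
have noninj (D : {set 'I_j.+1}) u v : u \in D -> v \in D -> u != v -> a u = a v ->
    ~ {in D &, injective a}.
  by move=> uD vD uv auv aD; move: uv; rewrite (aD _ _ uD vD auv) eqxx.
rewrite (bigD1 x) //= (bigD1 y) ?yF ?nyx //= big1 ?addr0; last first.
  move=> i /andP[/andP[iF ix] iy]; rewrite pull_eq0 ?mulr0 //=.
  by apply: (@noninj _ x y) => //; rewrite !inE eq_sym ?ix ?iy.
have im z z' : z \in c.1 -> z' \in c.1 -> z != z' -> a z = a z' ->
    a @: (c.1 :\ z) = a @: c.1.
  move=> zF zF' ne ezz; apply/setP => t; apply/imsetP/imsetP => -[l].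
    by move=> /setD1P[_ lF] ->; exists l.
  move=> lF ->; have [->|nl] := eqVneq l z; last by exists l; rewrite // !inE nl.
  by exists z' => //; rewrite !inE zF' eq_sym ne.
have imx := im x y xF yF nxy e; have imy := im y x yF xF nyx (esym e).
have cC' z z' : z \in c.1 -> z' \in c.1 -> z != z' -> a z = a z' ->
    is_cell sigma (c.1 :\ z, c.2).
  move=> zF zF' ne ezz; have /and3P[rs cE /forallP cF] := cC; apply/and3P; split=> //.
  apply/forallP => i; have /orP[->//|/set0Pn[l]] := cF i; rewrite inE => /andP[lF sl].
  apply/orP; right; apply/set0Pn; have [lz|nl] := eqVneq l z.
    by exists z'; rewrite !inE zF' eq_sym ne /= chain_compE -ezz -lz -chain_compE.
  by exists l; rewrite !inE nl lF.
have card_eq : #|c.1 :\ x| = #|c.1 :\ y|.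
  by have := cardsD1 x c.1; rewrite xF (cardsD1 y) yF => /addnI ->.
have [/dinjectiveP ax|/dinjectiveP ax] := boolP (dinjectiveb a (mem (c.1 :\ x))); last first.
  have ay : ~ {in c.1 :\ y &, injective a}.
    by move=> /imset_injP; rewrite imy -imx -card_eq => /imset_injP.
  by rewrite !pull_eq0 //= !mulr0 addr0.
have ay : {in c.1 :\ y &, injective a}.
  by apply/imset_injP; rewrite imy -imx -card_eq; apply/imset_injP.
rewrite !pullE //; try by [exact: (cC' x y)|exact: (cC' y x)].
rewrite /push_cell /= imx imy -mulrDl [X in X * _](_ : _ = 0) ?mul0r //.
rewrite /vertex_sign !chain_compE -e !exprD -mulrDr.
rewrite [in X in _ + X](_ : [set _ in _ | _] =
   x |: [set l in block_face sigma c (tau (a x)) | (l < x)%N]).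
  by rewrite cardsU1 !inE ltnn andbF add1n exprS mulN1r addrN mulr0.
apply/setP => l; rewrite !inE; have [->|nlx] := eqVneq l x.
  by rewrite xF chain_compE eqxx xy.
case: (boolP (l \in c.1)) => //= lF; case: eqP => //= sl.
apply/idP/idP => [ly|lx]; last exact: ltn_trans lx xy.
rewrite ltnNge; apply/negP => xl.
have aly : a l = a y.
  have l1 := chain_le a xl; have l2 := chain_le a (ltnW ly).
  by apply/eqP; rewrite eq_le l2 -e l1.
have := ax l y; rewrite !inE nlx lF nyx yF => /(_ isT isT aly) ely.
by rewrite ely ltnn in ly.
Qed.

Lemma pull_id k (sigma : chain P k) (w : cochain k) :
  (forall c, w c != 0 -> is_cell sigma c) -> pull sigma (simplex_id k) w = w.
Proof.
move=> wC; apply/funext => -[F E]; rewrite /pull chain_compx1.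
have -> /= : dinjectiveb (simplex_id k) (mem F).
  by apply/dinjectiveP => x y _ _; rewrite !simplex_idE.
rewrite andbT; have [cC|cN] := boolP (is_cell sigma (F, E)); last first.
  by apply/esym/eqP; apply: contraNT cN => /wC.
congr w; rewrite /push_cell /= chain_compx1 fsetDv fsetU0; congr pair.
by rewrite (eq_imset (g := id)) ?imset_id // => i; rewrite simplex_idE.
Qed.

Lemma pull_comp i j k (tau : chain P k) (a : simplex_map j k) (b : simplex_map i j)
    (w : cochain k) :
  pull tau (chain_comp a b) w = pull (chain_comp tau a) b (pull tau a w).
Proof.
apply/funext => c; rewrite /pull -chain_compA.
have [cC|//] /= := boolP (is_cell (chain_comp tau (chain_comp a b)) c).
rewrite chain_compA in cC.
case: (dinjectiveP b (mem c.1)) => [cb|cb]; last first.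
  case: dinjectiveP => // cab; case: cb => x y xF yF e; apply: cab => //.
  by rewrite !chain_compE e.
rewrite push_cellP //=.
have -> : dinjectiveb (chain_comp a b) (mem c.1) =
          dinjectiveb a (mem (push_cell (chain_comp tau a) b c).1).
  apply/dinjectiveP/dinjectiveP => [cab _ _ /imsetP[x xF ->] /imsetP[y yF ->] e|ca x y xF yF].
    by congr (b _); apply: cab; rewrite // !chain_compE.
  by rewrite !chain_compE => /ca e; apply: cb => //; apply: e; apply: imset_f.
case: ifP => // _; congr w; rewrite /push_cell /=; congr pair.
  apply/setP => y; apply/imsetP/imsetP => [[l lF ->]|[_ /imsetP[l lF ->] ->]].
    by exists (b l); rewrite ?imset_f // chain_compE.
  by exists l; rewrite // chain_compE.
rewrite chain_compA; apply/fsetP => s; rewrite !inE.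
have /fsubsetP/(_ s) := blocks_sub (chain_comp tau a) b.
have /fsubsetP/(_ s) := blocks_sub tau a.
case: (s \in blocks tau); case: (s \in blocks (chain_comp tau a));
case: (s \in blocks (chain_comp (chain_comp tau a) b)); case: (s \in c.2);
by [|move=> /(_ isT)|move=> _ /(_ isT)].
Qed.

Lemma blownup_supp k (sigma : chain P k) p n (w : cochain k) :
  blownup sigma p n w -> forall c, w c != 0 -> is_cell sigma c.
Proof. by case=> H _ _ c /H[]. Qed.

Lemma blownup_pull j k (tau : chain P k) (a : simplex_map j k) p n (w : cochain k) :
  blownup tau p n w -> blownup (chain_comp tau a) p n (pull tau a w).
Proof.
move=> wB; have [wn wp dwp] := wB; split.
- exact: homogeneous_pull.
- exact: allowable_pull.
- by rewrite -pull_coboundary; [exact: allowable_pull|exact: blownup_supp wB].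
Qed.

Lemma blownup_cocycle_pull j k (tau : chain P k) (a : simplex_map j k) p n
    (w : cochain k) :
  blownup_cocycle tau p n w ->
  blownup_cocycle (chain_comp tau a) p n (pull tau a w).
Proof.
case=> wB dw; split; first exact: blownup_pull.
rewrite -pull_coboundary; last exact: blownup_supp wB.
by rewrite dw; apply/funext => c; rewrite /pull if_same.
Qed.


Lemma pull_lin j k (tau : chain P k) (a : simplex_map j k) r (v w : cochain k) :
  pull tau a (fun c => r * v c + w c) = fun c => r * pull tau a v c + pull tau a w c.
Proof. by apply/funext => c; rewrite /pull; case: ifP => // _; rewrite mulr0 addr0. Qed.

Lemma coboundary_lin k (sigma : chain P k) r (v w : cochain k) :
  coboundary sigma (fun c => r * v c + w c) =
  fun c => r * coboundary sigma v c + coboundary sigma w c.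
Proof.
apply/funext => c; rewrite /coboundary; case: ifP => [_|]; last by rewrite mulr0 addr0.
under eq_bigr do rewrite mulrDr mulrCA.
under [X in _ + X = _]eq_bigr do rewrite mulrDr mulrCA.
by rewrite !big_split /= -!mulr_sumr mulrDr addrACA.
Qed.

Lemma blownup0 k (sigma : chain P k) p n : blownup sigma p n (fun=> 0 : R).
Proof.
have d0 : coboundary sigma (fun=> 0 : R) = fun=> 0.
  apply/funext => c; rewrite /coboundary; case: ifP => // _.
  by rewrite !big1 ?addr0 // => ? _; rewrite mulr0.
split; [by move=> c; rewrite eqxx| |rewrite d0];
  by apply/allowableP => c s _; rewrite eqxx.
Qed.

Lemma lin_neq0 (r x y : R) : r * x + y != 0 -> x != 0 \/ y != 0.
Proof.
have [->|x0] := eqVneq x 0; last by left.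
by rewrite mulr0 add0r; right.
Qed.

Lemma blownup_lin k (sigma : chain P k) p n r (v w : cochain k) :
  blownup sigma p n v -> blownup sigma p n w ->
  blownup sigma p n (fun c => r * v c + w c).
Proof.
have lin (f g : cochain k) : allowable sigma p f -> allowable sigma p g ->
    allowable sigma p (fun c => r * f c + g c).
  move=> /allowableP fp /allowableP gp; apply/allowableP => c s cC.
  by case/lin_neq0; [exact: fp|exact: gp].
case=> vn vp dvp [wn wp dwp]; split; [|exact: lin|].
  by move=> c /lin_neq0[/vn|/wn].
by rewrite coboundary_lin; exact: lin.
Qed.

Section EilenbergMacLane.
Variables (n : int) (p : perversity).

Definition EM_obj (k : nat) : Type :=
  {x : chain P k * cochain k | `[< blownup_cocycle x.1 p n x.2 >]}.

Fact EM_act_subproof j k (a : simplex_map j k) (x : EM_obj k) :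
  `[< blownup_cocycle (chain_comp (val x).1 a) p n (pull (val x).1 a (val x).2) >].
Proof. by apply/asboolP/blownup_cocycle_pull; have /asboolP := valP x. Qed.

Definition EM_act j k (a : simplex_map j k) (x : EM_obj k) : EM_obj j :=
  exist _ (chain_comp (val x).1 a, pull (val x).1 a (val x).2)
    (EM_act_subproof a x).

Lemma EM_act1 k (x : EM_obj k) : EM_act (simplex_id k) x = x.
Proof.
case: x => -[sigma w] xP; have /asboolP[/= wB _] := xP.
apply/val_inj; rewrite /= chain_compx1 pull_id //; exact: blownup_supp wB.
Qed.

Lemma EM_actM i j k (a : simplex_map j k) (b : simplex_map i j) (x : EM_obj k) :
  EM_act (chain_comp a b) x = EM_act b (EM_act a x).
Proof. by apply/val_inj; rewrite /= chain_compA pull_comp. Qed.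

Definition EM_sset : sset := Sset EM_act1 EM_actM.

Fact EM_proj_subproof j k (a : simplex_map j k) (x : EM_sset k) :
  (val (sset_act EM_sset a x)).1 = sset_act nerve a (val x).1.
Proof. by []. Qed.

Definition EM_proj : sset_map EM_sset nerve :=
  @SsetMap EM_sset nerve (fun k (x : EM_obj k) => (val x).1) EM_proj_subproof.

(* The presheaf of n-cocycles, as the simplicial set over N(P) of the pairs of *)
(* a simplex sigma of N(P) and a cocycle on sigma.                             *)
Definition EM_space : ssetP := SsetP EM_proj.

End EilenbergMacLane.

Definition cofamily (L : ssetP) : Type := forall k, L k -> cochain k.

End Cochains.

Section CofamilyModule.
Variables (R : comPzRingType) (L : ssetP).
Local Notation V := (cofamily R L).

HB.instance Definition _ := gen_eqMixin V.
HB.instance Definition _ := gen_choiceMixin V.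

Definition cofam0 : V := fun k x c => 0.
Definition cofam_add (v w : V) : V := fun k x c => v k x c + w k x c.
Definition cofam_opp (v : V) : V := fun k x c => - v k x c.
Definition cofam_scale (r : R) (v : V) : V := fun k x c => r * v k x c.

Lemma cofam_ext (v w : V) : (forall k x c, v k x c = w k x c) -> v = w.
Proof.
by move=> vw; apply/functional_extensionality_dep => k; do 2 apply/funext => ?.
Qed.

Fact cofam_addA : associative cofam_add.
Proof. by move=> u v w; apply: cofam_ext => *; exact: addrA. Qed.
Fact cofam_addC : commutative cofam_add.
Proof. by move=> v w; apply: cofam_ext => *; exact: addrC. Qed.
Fact cofam_add0 : left_id cofam0 cofam_add.
Proof. by move=> v; apply: cofam_ext => *; exact: add0r. Qed.
Fact cofam_addN : left_inverse cofam0 cofam_opp cofam_add.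
Proof. by move=> v; apply: cofam_ext => *; exact: addNr. Qed.

HB.instance Definition _ :=
  GRing.isZmodule.Build V cofam_addA cofam_addC cofam_add0 cofam_addN.

Fact cofam_scaleA r s v : cofam_scale r (cofam_scale s v) = cofam_scale (r * s) v.
Proof. by apply: cofam_ext => *; exact: mulrA. Qed.
Fact cofam_scale1 : left_id 1 cofam_scale.
Proof. by move=> v; apply: cofam_ext => *; exact: mul1r. Qed.
Fact cofam_scaleDr : right_distributive cofam_scale +%R.
Proof. by move=> r v w; apply: cofam_ext => *; exact: mulrDr. Qed.
Fact cofam_scaleDl v : {morph cofam_scale^~ v : r s / r + s}.
Proof. by move=> r s; apply: cofam_ext => *; exact: mulrDl. Qed.

HB.instance Definition _ := GRing.Zmodule_isLmodule.Build R V
  cofam_scaleA cofam_scale1 cofam_scaleDr cofam_scaleDl.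

End CofamilyModule.


Section Cohomology.
Variables (R : comPzRingType) (p : perversity).

Section Space.
Variable L : ssetP.
Local Notation V := (cofamily R L).

(* The morphisms over N(P) from L to the presheaf of blown-up n-cochains.      *)
Definition blownup_family (n : int) : {pred V} := fun w =>
  `[< (forall k (x : L k), blownup (supp x) p n (w k x)) /\
      (forall j k (a : simplex_map j k) (x : L k),
         w j (sset_act L a x) = pull (supp x) a (w k x)) >].

Fact blownup_family_closed n : submod_closed (blownup_family n).
Proof.
split=> [|r v w /asboolP[v1 v2] /asboolP[w1 w2]]; apply/asboolP; split.
- by move=> k x; exact: blownup0.
- by move=> j k a x; apply/funext => c; rewrite /pull if_same.
- by move=> k x; exact: blownup_lin.
- move=> j k a x; apply: etrans (esym (pull_lin (supp x) a r (v k x) (w k x))).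
  by rewrite -v2 -w2.
Qed.
HB.instance Definition _ n :=
  GRing.isSubmodClosed.Build R V (blownup_family n) (blownup_family_closed n).

Definition delta (w : V) : V := fun k x => coboundary (supp x) (w k x).

Fact delta_is_linear : linear delta.
Proof.
move=> r v w; apply: cofam_ext => k x c.
by rewrite [LHS](congr1 (@^~ c) (coboundary_lin (supp x) r (v k x) (w k x))).
Qed.
HB.instance Definition _ := GRing.isLinear.Build R V V _ delta delta_is_linear.

Definition cocycle (n : int) : {pred V} :=
  fun w => (w \in blownup_family n) && (delta w == 0).

Fact cocycle_closed n : submod_closed (cocycle n).
Proof.
split=> [|r v w /andP[v1 /eqP v2] /andP[w1 /eqP w2]]; apply/andP; split.
- exact: rpred0.
- by rewrite linear0.
- by rewrite rpredD ?rpredZ.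
- by rewrite linearP /= v2 w2 scaler0 addr0.
Qed.
HB.instance Definition _ n :=
  GRing.isSubmodClosed.Build R V (cocycle n) (cocycle_closed n).

Record cocycles (n : int) : Type :=
  Cocycle { cocycle_val :> V; _ : cocycle_val \in cocycle n }.
HB.instance Definition _ n := [isSub for @cocycle_val n].
HB.instance Definition _ n := [Choice of cocycles n by <:].
HB.instance Definition _ n := [SubChoice_isSubLmodule of cocycles n by <:].

Definition coboundaries (n : int) : {pred cocycles n} := fun w =>
  `[< exists2 v, v \in blownup_family (n - 1) & val w = delta v >].
Arguments coboundaries : clear implicits.

Fact coboundaries_closed n : submod_closed (coboundaries n).
Proof.
split=> [|r v w /asboolP[v' v1 v2] /asboolP[w' w1 w2]]; apply/asboolP.
  by exists 0; [exact: rpred0|rewrite (linear0 delta)].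
exists (r *: v' + w'); first by rewrite rpredD ?rpredZ.
by rewrite !linearP /= v2 w2.
Qed.
HB.instance Definition _ n :=
  GRing.isSubmodClosed.Build R (cocycles n) (coboundaries n) (coboundaries_closed n).

Definition cohomology (n : int) := lquot (coboundaries n).
HB.instance Definition _ n := GRing.Lmodule.on (cohomology n).

End Space.

Arguments blownup_family : clear implicits.
Arguments cocycle : clear implicits.
Arguments cocycles : clear implicits.
Arguments coboundaries : clear implicits.
Arguments cohomology : clear implicits.

Section Functoriality.
Variables (L M : ssetP) (f : ssetP_map L M) (n : int).

Definition pullback (w : cofamily R M) : cofamily R L := fun k x => w k (f k x).

Fact pullback_family m w :
  w \in blownup_family M m -> pullback w \in blownup_family L m.
Proof.
move=> /asboolP[w1 w2]; apply/asboolP; split => [k x|j k a x].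
  by rewrite -(spmap_proj f); exact: w1.
by rewrite /pullback -(spmap_proj f) -w2 smap_nat.
Qed.

Lemma pullback_delta w : delta (pullback w) = pullback (delta w).
Proof. by apply: cofam_ext => k x c; rewrite /delta /pullback spmap_proj. Qed.

Fact pullback_cocycle (w : cocycles M n) : pullback w \in cocycle L n.
Proof.
have /andP[w1 /eqP w2] := valP w; apply/andP; split; first exact: pullback_family.
by rewrite pullback_delta w2.
Qed.

Definition cocycle_pullback (w : cocycles M n) : cocycles L n :=
  Cocycle (pullback_cocycle w).

Definition cohomology_map (h : cohomology M n) : cohomology L n :=
  lclass (coboundaries L n) (cocycle_pullback (lrepr h)).

Lemma cohomology_mapE (w : cocycles M n) :
  cohomology_map (lclass (coboundaries M n) w) =
  lclass (coboundaries L n) (cocycle_pullback w).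
Proof.
apply/lclass_eq/asboolP.
have /lclass_eq/asboolP[v v1 v2] := lreprK (lclass (coboundaries M n) w).
exists (pullback v); first exact: pullback_family.
by rewrite pullback_delta -v2.
Qed.

Fact cohomology_map_is_linear : linear cohomology_map.
Proof.
move=> r x y; rewrite -(lreprK x) -(lreprK y) -linearP !cohomology_mapE -linearP.
by congr lclass; apply/val_inj.
Qed.
HB.instance Definition _ := GRing.isLinear.Build R (cohomology M n) (cohomology L n)
  _ cohomology_map cohomology_map_is_linear.

End Functoriality.
End Cohomology.

Section Operations.
Variables (R : comPzRingType) (p : perversity) (n : int) (q : perversity) (m : int).

(* The components are not required to be additive: an operation is natural     *)
(* between the underlying set-valued functors (e.g. a cup square).              *)
Record operation := Operation {
  op_fun :> forall L : ssetP, cohomology R p L n -> cohomology R q L m;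
  op_nat : forall (L M : ssetP) (f : ssetP_map L M) (h : cohomology R p M n),
    op_fun (cohomology_map f h) = cohomology_map f (op_fun h) }.

Fact operation_add_subproof (e e' : operation) L M (f : ssetP_map L M) h :
  e L (cohomology_map f h) + e' L (cohomology_map f h) =
  cohomology_map f (e M h + e' M h).
Proof. by rewrite !op_nat linearD. Qed.

Definition operation_add (e e' : operation) : operation :=
  Operation (operation_add_subproof e e').

Fact operation_scale_subproof (r : R) (e : operation) L M (f : ssetP_map L M) h :
  r *: e L (cohomology_map f h) = cohomology_map f (r *: e M h).
Proof. by rewrite op_nat linearZ. Qed.

Definition operation_scale (r : R) (e : operation) : operation :=
  Operation (operation_scale_subproof r e).

End Operations.
End Poset.

(* Main.v *)
Require Import Defs.
From HB Require Import structures.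
From mathcomp Require Import all_boot all_order all_algebra.
From mathcomp Require Import finmap boolp constructive_ereal zify.

Set Implicit Arguments.
Unset Strict Implicit.
Unset Printing Implicit Defensive.

Import Order.TTheory GRing.Theory.
Local Open Scope ring_scope.

(* Yoneda: a cocycle w on L is the same as a map classify w : L -> K over N(P), *)
(* and it is the pullback of the tautological cocycle of K.  An operation is    *)
(* thus determined by its value on the class of that cocycle; conversely        *)
(* c in H^m_q(K) defines the operation [w] |-> (classify w)^* c, provided that  *)
(* cohomologous cocycles w and w' = w - delta v have classifying maps inducing  *)
(* the same map on H_q.  They are the two ends of the classifying map of the    *)
(* cocycle w' + delta (t \cup v) on L * Delta[1], where t is the 0-cochain with *)
(* value i at the vertex i of Delta[1]; so it remains to see that H_q is        *)
(* homotopy invariant.  The homotopy is the prism operator applied blockwise:   *)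
(* it evaluates on the cells (F, E) in which one vertex of F is doubled, which  *)
(* can only raise the perverse degree, so it preserves allowability.            *)

(** * Signs of the coboundary *)

(** The isomorphism evaluates an operation at [EM_class], and its inverse is [represented]. Since
    every class is a pullback of [EM_class] along a classifying map ([classify_class]), an operation
    is determined by this value. Conversely, [represented] is natural only if the choice of a
    representing cocycle is irrelevant, which is [classify_cohomologous]. That lemma combines
    [cut_family], which interpolates between a cochain and 0 along the cylinder, with homotopy
    invariance, [cyl_end_cohomology], which follows from [prism_homotopy]. Koszul signs are removed
    by [coboundaryE]: up to a sign depending on the block alone, the coboundary is that of one
    simplex spanned by all vertices and apexes of the cell. Sign identities then only compare
    positions in a list. Allowability rests on [perverse_degree_del_first] for the cut and on
    [perverse_degree_double] for the prism. *)

Lemma big_antisym (V : zmodType) (I : eqType) (r : seq I) (f : I -> I -> V) :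
  uniq r -> {in r &, forall x y, x != y -> f x y + f y x = 0} ->
  \sum_(x <- r) \sum_(y <- r | y != x) f x y = 0.
Proof.
elim: r => [|a r IH] /=; first by rewrite big_nil.
move=> /andP[ar ur] fA; rewrite big_cons big_cons eqxx /=.
have ne x : x \in r -> (a != x) && (x != a).
  by move=> xr; rewrite [x == a]eq_sym andbb; apply: contraNneq ar => ->.
rewrite [X in _ + X](eq_big_seq (fun x => f x a + \sum_(y <- r | y != x) f x y)).
  rewrite big_split /= IH // ?addr0; last first.
    by move=> x y xr yr; apply: fA; rewrite inE ?xr ?yr orbT.
  rewrite big_mkcond -big_split /= big1_seq // => x /andP[_ xr].
  by have /andP[h1 h2] := ne _ xr; rewrite h2 fA ?inE ?eqxx ?xr ?orbT.
by move=> x xr; rewrite big_cons; have /andP[-> _] := ne _ xr.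
Qed.

Section Signs.
Variables (R : comPzRingType) (d : Order.disp_t) (P : porderType d) (k : nat).
Variable sigma : chain P k.
Implicit Types (c : cell P k) (w : cochain P R k).

(* The vertices of a cell (F, E): those of F, and one apex for each s in E.   *)
Definition item := ('I_k.+1 + P)%type.
Implicit Types z : item.

Definition items c : seq item :=
  [seq inl i | i <- enum c.1] ++ [seq inr s | s <- enum_fset c.2].

Definition del c z : cell P k :=
  match z with
  | inl i => (c.1 :\ i, c.2)
  | inr s => (c.1, (c.2 `\ s)%fset)
  end.

(* The order of the vertices of the join: an apex is last in its block.      *)
Definition before z z' : bool :=
  match z, z' with
  | inl i, inl j => (i < j)%N
  | inl i, inr s => (sigma i <= s)%O
  | inr s, inl i => (s < sigma i)%O
  | inr s, inr t => (s < t)%O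
  end.

Definition rank c z : nat := count (before^~ z) (items c).

Definition item_block z : P := match z with inl i => sigma i | inr s => s end.

(** The exponent counts the blocks below [s]; it turns dimensions of the preceding factors into
    numbers of vertices, in a way independent of the cell. *)
Definition block_sign (s : P) : R :=
  (-1) ^+ (\sum_(t <- blocks sigma | (t < s)%O) 1)%N.

Lemma mem_items c z :
  (z \in items c) = match z with inl i => i \in c.1 | inr s => s \in c.2 end.
Proof.
have injl : injective (@inl 'I_k.+1 P) by move=> ? ? [].
have injr : injective (@inr 'I_k.+1 P) by move=> ? ? [].
rewrite mem_cat; case: z => [i|s].
  rewrite mem_map // mem_enum; case: (i \in c.1) => //=.
  by apply/negbTE/negP => /mapP[].
by rewrite mem_map // orbC; case: (s \in c.2) => //=; apply/negbTE/negP => /mapP[].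
Qed.

Lemma uniq_items c : uniq (items c).
Proof.
rewrite cat_uniq !map_inj_uniq; try by move=> ? ? [].
rewrite enum_uniq fset_uniq andbT /=; apply/hasPn => _ /mapP[s _ ->].
by apply/negP => /mapP[].
Qed.

Lemma items_del c z : z \in items c -> perm_eq (items c) (z :: items (del c z)).
Proof.
move=> zc; apply: uniq_perm; rewrite ?uniq_items //=.
  by rewrite uniq_items andbT mem_items; case: z zc => /= *; rewrite !inE eqxx.
move=> y; rewrite inE; move: zc; rewrite !mem_items.
case: z y => [i|s] [j|t] //= zc.
  rewrite in_setD1 -[inl j == inl i]/(j == i).
  by case: eqVneq => //= ->.
rewrite in_fsetD1 -[inr t == inr s]/(t == s).
by case: eqVneq => //= ->.
Qed.

Lemma items_delE c z : z \in items c ->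
  perm_eq (items (del c z)) [seq y <- items c | y != z].
Proof.
move=> zc; rewrite perm_sym -(rem_filter _ (uniq_items c)) -(perm_cons z).
by rewrite -(permPl (perm_to_rem zc)) items_del.
Qed.

Lemma rank_del c z z' : z \in items c ->
  rank c z' = (before z z' + rank (del c z) z')%N.
Proof. by move=> zc; rewrite /rank (permP (items_del zc)). Qed.

Lemma delC c z z' : del (del c z) z' = del (del c z') z.
Proof.
case: z z' => [i|s] [j|t] //=; congr pair.
  by apply/setP => l; rewrite !inE andbCA.
by apply/fsetP => l; rewrite !inE andbCA.
Qed.

Lemma count_enum (F : {set 'I_k.+1}) (Q : pred 'I_k.+1) :
  count Q (enum F) = #|[set i in F | Q i]|.
Proof.
rewrite -sum1_count big_enum_cond /= -sum1_card; apply: eq_bigl => i.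
by rewrite inE.
Qed.

Lemma rank_vertex c i :
  rank c (inl i) = (#|[set j in c.1 | (j < i)%N]| +
                    count (fun s => (s < sigma i)%O) c.2)%N.
Proof. by rewrite /rank count_cat !count_map count_enum. Qed.

Lemma rank_apex c s :
  rank c (inr s) = (#|[set j in c.1 | (sigma j <= s)%O]| +
                    count (fun t => (t < s)%O) c.2)%N.
Proof. by rewrite /rank count_cat !count_map count_enum. Qed.

Lemma big_block_face c (Q : pred P) :
  (\sum_(t <- blocks sigma | Q t) #|block_face sigma c t|)%N =
  #|[set i in c.1 | Q (sigma i)]|.
Proof.
under eq_bigr => t _ do rewrite -sum1_card big_mkcond.
rewrite exchange_big /= -sum1_card [RHS]big_mkcond; apply: eq_bigr => i _.
rewrite inE big_mkcond (bigD1_seq (sigma i)) ?fset_uniq ?blocks_in //=.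
rewrite inE eqxx andbT big1 ?addn0; last first.
  by move=> t ti; rewrite inE [_ == t]eq_sym (negbTE ti) andbF if_same.
by case: (i \in c.1); case: (Q _).
Qed.

Lemma cell_apex_block c s : is_cell sigma c -> s \in c.2 -> s \in blocks sigma.
Proof. by case/and3P => _ /fsubsetP H _ /H; rewrite !inE => /andP[]. Qed.

Lemma item_in_block c z : is_cell sigma c -> z \in items c ->
  item_block z \in blocks sigma.
Proof.
rewrite mem_items; case: z => [i|s] cC /=; first by rewrite blocks_in.
exact: cell_apex_block.
Qed.

(** Each factor has one vertex more than its dimension. *)
Lemma sum_factor_dim c (Q : pred P) : is_cell sigma c ->
  (\sum_(t <- blocks sigma | Q t) factor_dim sigma c t +
   \sum_(t <- blocks sigma | Q t) 1 =
   #|[set i in c.1 | Q (sigma i)]| + count Q c.2)%N.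
Proof.
move=> cC; rewrite -big_split /= -(big_block_face c Q).
have -> : (count Q c.2 = \sum_(t <- blocks sigma | Q t) (t \in c.2))%N.
  rewrite -sum1_count [LHS]big_mkcond [RHS]big_mkcond /=.
  rewrite (eq_big_seq (fun t => if Q t then (t \in c.2 : nat) else 0%N)); last first.
    by move=> t tc; rewrite tc.
  apply: big_fset_incl => [|t _ /negbTE ->]; last by rewrite if_same.
  by apply/fsubsetP => t; apply: cell_apex_block.
rewrite -big_split big_seq_cond [RHS]big_seq_cond /=.
(* No factor of a cell is empty, so the truncated predecessor in [factor_dim] is exact. *)
apply: eq_bigr => t /andP[/mem_blocks[i ->] _]; rewrite /factor_dim addn1 prednK //.
have /and3P[_ _ /forallP/(_ i)] := cC.
by case: (sigma i \in c.2) => /=; rewrite ?addn1 // addn0 card_gt0.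
Qed.

Lemma koszul_sign c s : is_cell sigma c ->
  (-1) ^+ koszul sigma c s = block_sign s *
    (-1) ^+ (#|[set i in c.1 | (sigma i < s)%O]| + count (fun t => (t < s)%O) c.2) :> R.
Proof.
move=> cC; rewrite -(sum_factor_dim (fun t => t < s)%O) // exprD mulrCA -exprD.
by rewrite addnn -mul2n exprM sqrrN !expr1n mulr1.
Qed.

Lemma vertex_signE c i : is_cell sigma c ->
  vertex_sign R sigma c i = block_sign (sigma i) * (-1) ^+ rank c (inl i).
Proof.
move=> cC; rewrite /vertex_sign exprD koszul_sign // -mulrA -exprD rank_vertex.
congr (_ * _ ^+ _); rewrite addnAC; congr (_ + _)%N.
(* The vertices in lower blocks and the earlier ones in the block of [i] are disjoint and together
   are all the vertices before [i]. *)
rewrite -cardsUI [X in (_ + X)%N](_ : _ = 0%N) ?addn0.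
  apply: eq_card => j; rewrite !inE; case: (j \in c.1) => //=.
  case: (ltngtP j i) => [ji|ij|/val_inj ->]; last by rewrite ltxx andbF.
    by have := chain_le sigma (ltnW ji); rewrite andbT le_eqVlt orbC.
  have := chain_le sigma (ltnW ij); rewrite andbF orbF.
  by move=> /le_gtF.
apply/eqP; rewrite cards_eq0; apply/eqP/setP => j; rewrite !inE.
by case: eqP => [->|_]; rewrite ?ltxx ?andbF.
Qed.

Lemma apex_signE c s : is_cell sigma c ->
  apex_sign R sigma c s = block_sign s * (-1) ^+ rank c (inr s).
Proof.
move=> cC; rewrite /apex_sign exprD koszul_sign // -mulrA -exprD rank_apex.
congr (_ * _ ^+ _); rewrite addnAC; congr (_ + _)%N.
rewrite -cardsUI [X in (_ + X)%N](_ : _ = 0%N) ?addn0.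
  by apply: eq_card => j; rewrite !inE le_eqVlt orbC andb_orr.
apply/eqP; rewrite cards_eq0; apply/eqP/setP => j; rewrite !inE.
by case: eqP => [->|_]; rewrite ?ltxx ?andbF.
Qed.

Definition item_sign c z : R := block_sign (item_block z) * (-1) ^+ rank c z.

Lemma coboundaryE w c : is_cell sigma c ->
  coboundary sigma w c = \sum_(z <- items c) item_sign c z * w (del c z).
Proof.
move=> cC; rewrite /coboundary cC big_cat !big_map /= big_enum /=; congr (_ + _).
  by apply: eq_bigr => i _; rewrite vertex_signE.
by apply: eq_bigr => s _; rewrite apex_signE.
Qed.

Lemma is_cell_del c z : is_cell sigma c -> is_cell sigma (del c z) =
  [forall i, (sigma i \in (del c z).2) || (block_face sigma (del c z) (sigma i) != set0)].
Proof.
case/and3P => rs cE _; rewrite /is_cell rs; case: z => [i|s] /=; first by rewrite cE.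
by rewrite (fsubset_trans (fsubD1set _ _) cE).
Qed.

(** A factor once emptied stays empty, so in a double coboundary no nonzero term passes through a
    pair that is not a cell. *)
Lemma is_cell_del2 c z z' :
  is_cell sigma c -> is_cell sigma (del (del c z) z') -> is_cell sigma (del c z).
Proof.
move=> cC /and3P[_ _ /forallP H]; rewrite is_cell_del //; apply/forallP => i.
have {H} /orP[h|/set0Pn[j h]] := H i.
  by apply/orP; left; case: z' h => //= s; rewrite !inE => /andP[].
apply/orP; right; apply/set0Pn; exists j; case: z' h => [l|s]; rewrite !inE //=.
by rewrite -andbA => /andP[].
Qed.

Lemma comparable_blocks s t : s \in blocks sigma -> t \in blocks sigma ->
  (s >=< t)%O.
Proof.
move=> /mem_blocks[i ->] /mem_blocks[j ->]; rewrite /Order.comparable.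
by case: (leqP i j) => [|/ltnW] /(chain_le sigma) ->; rewrite ?orbT.
Qed.

Lemma beforeN c z z' : is_cell sigma c -> z \in items c -> z' \in items c ->
  z != z' -> before z' z = ~~ before z z'.
Proof.
move=> cC zc z'c.
have := comparable_blocks (item_in_block cC zc) (item_in_block cC z'c).
case: z z' {zc z'c} => [i|s] [j|t] /=.
- move=> _ ne; rewrite -leqNgt [RHS]leq_eqVlt orbC.
  by case: ltnP => //= h; symmetry; apply/negbTE; apply: contra ne => /eqP/val_inj ->.
- by move=> /comparable_leNgt-> _; rewrite negbK.
- by move=> /comparable_ltNge-> _; rewrite negbK.
move=> cst ne; rewrite -comparable_leNgt 1?comparable_sym // le_eqVlt orbC.
by case: (_ < _)%O => //=; symmetry; apply/negbTE; apply: contra ne => /eqP ->.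
Qed.

(** Reduces every comparison of degrees to counting items, the number of blocks being fixed. *)
Lemma cell_dim_items c : is_cell sigma c ->
  (cell_dim sigma c + size (blocks sigma) = size (items c))%N.
Proof.
move=> /(sum_factor_dim predT); rewrite /cell_dim !sum1_size => ->.
rewrite size_cat !size_map count_predT -cardE; congr (_ + _)%N.
by apply: eq_card => i; rewrite inE andbT.
Qed.

Lemma coboundary_neq0 w c : coboundary sigma w c != 0 ->
  is_cell sigma c /\ exists2 z, z \in items c & w (del c z) != 0.
Proof.
have [cC|/negbTE cN] := boolP (is_cell sigma c); last first.
  by rewrite /coboundary cN eqxx.
rewrite coboundaryE // => dw; split=> //; apply/hasP; apply: contraNT dw.
move=> /hasPn H; rewrite big1_seq // => z /andP[_ /H/negPn/eqP ->].
by rewrite mulr0.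
Qed.

Lemma homogeneous_coboundary n w :
  homogeneous sigma (n - 1) w -> homogeneous sigma n (coboundary sigma w).
Proof.
move=> wn c /coboundary_neq0[cC [z zc /wn[zC dim_z]]]; split=> //.
apply: (addIr (- 1)); rewrite -dim_z; apply: (addrI (size (blocks sigma))%:Z).
rewrite addrA -!PoszD ![(size (blocks sigma) + _)%N]addnC !cell_dim_items //.
by rewrite (perm_size (items_del zc)) /= -addn1 PoszD addrK.
Qed.

(** The two orders of deleting [z] and [z'] reach the same cell. The first deletion lowers the rank
    of the other item in exactly one of these orders, so the signs are opposite. *)
Lemma coboundaryK w : (forall c, w c != 0 -> is_cell sigma c) ->
  coboundary sigma (coboundary sigma w) = fun=> 0.
Proof.
move=> wC; apply/funext => c; have [cC|/negbTE cN] := boolP (is_cell sigma c); last first.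
  by rewrite /coboundary cN.
rewrite coboundaryE // -[RHS](@big_antisym R _ (items c) (fun z z' =>
  block_sign (item_block z) * block_sign (item_block z') *
  (-1) ^+ (rank c z + rank c z' + before z z') * w (del (del c z) z'))) ?uniq_items //.
  apply: eq_big_seq => z zc.
  have [zC|/negbTE zN] := boolP (is_cell sigma (del c z)); last first.
    rewrite /coboundary zN mulr0 big1 // => z' _.
    have -> : w (del (del c z) z') = 0; last by rewrite mulr0.
    apply/eqP/negPn/negP => /wC /(is_cell_del2 cC); by rewrite zN.
  rewrite coboundaryE // mulr_sumr (perm_big _ (items_delE zc)) big_filter /=.
  apply: eq_bigr => z' _; rewrite mulrA /item_sign mulrACA.
  congr (_ * _ * _); rewrite [in RHS](rank_del z' zc); case: before => /=.
    by rewrite addn1 add1n addnS !exprS exprD !mulN1r opprK.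
  by rewrite addn0 exprD.
move=> z z' zc z'c ne; rewrite (delC c z') (beforeN cC zc z'c) //.
rewrite [block_sign (item_block z') * _]mulrC [(rank c z' + _)%N]addnC -mulrDl.
rewrite -mulrDr !exprD -mulrDr.
by case: before; rewrite /= expr0 expr1 ?subrr ?addNr !mulr0 mul0r.
Qed.

Lemma blownup_coboundary p n w :
  blownup sigma p (n - 1) w -> blownup_cocycle sigma p n (coboundary sigma w).
Proof.
move=> wB; have [wn _ dwp] := wB.
have ddw := coboundaryK (blownup_supp wB); split=> //; split=> //.
  exact: homogeneous_coboundary.
by rewrite ddw; have [] := blownup0 R sigma p n.
Qed.

End Signs.

(** * Product with the coordinate of Delta[1] *)

Section Cut.
Variables (R : comPzRingType) (d : Order.disp_t) (P : porderType d).

(* The cup product t \cup v, with t evaluated at the first vertex of F: the     *)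
(* extra terms of its coboundary come from deleting this vertex, which lies in  *)
(* the lowest block met by F, and this does not change the perverse degree.     *)
(* Since t is monotone, it is 1 on F as soon as it is 1 at the first vertex.    *)
Definition cut k (t : simplex_map k 1) (w : cochain P R k) : cochain P R k :=
  fun c => if [forall i in c.1, t i == ord_max] then w c else 0.

Lemma cut_neq0 k (t : simplex_map k 1) (w : cochain P R k) c :
  cut t w c != 0 -> {in c.1, forall i, t i = ord_max} /\ w c != 0.
Proof.
rewrite /cut; case: ifP => [/forall_inP H|]; last by rewrite eqxx.
by move=> wc; split=> // i /H /eqP.
Qed.

Lemma cut1 k (t : simplex_map k 1) (w : cochain P R k) :
  (forall i, t i = ord_max) -> cut t w = w.
Proof.
move=> t1; apply/funext => c; rewrite /cut ifT //.
by apply/forall_inP => i _; rewrite t1.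
Qed.

(** The last block is never coned, so [F] must meet it. *)
Lemma cell_vertex k (sigma : chain P k) c : is_cell sigma c -> exists i, i \in c.1.
Proof.
move=> /and3P[_ /fsubsetP cE /forallP/(_ ord_max)] /orP[/cE|/set0Pn[i]].
  by rewrite !inE eqxx.
by rewrite inE => /andP[? _]; exists i.
Qed.

Lemma cut0 k (sigma : chain P k) (t : simplex_map k 1) (w : cochain P R k) :
  (forall c, w c != 0 -> is_cell sigma c) -> (forall i, t i = ord0) ->
  cut t w = fun=> 0.
Proof.
move=> wC t0; apply/funext => c; apply/eqP/negPn/negP => /cut_neq0[t1 /wC].
by move=> /cell_vertex[i /t1]; rewrite t0.
Qed.

Lemma pull_cut j k (tau : chain P k) (a : simplex_map j k) t (w : cochain P R k) :
  pull tau a (cut t w) = cut (chain_comp t a) (pull tau a w).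
Proof.
apply/funext => c; rewrite /pull /cut; case: ifP => _; last by rewrite if_same.
congr (if _ then _ else _); apply/forall_inP/forall_inP => [H i iF|H _ /imsetP[i iF ->]].
  by rewrite chain_compE H // imset_f.
by have := H i iF; rewrite chain_compE.
Qed.

Section Blownup.
Variables (k : nat) (sigma : chain P k) (t : simplex_map k 1) (p : perversity P).

(** If the block of [s] is not coned, it still contains a vertex after the deletion. That vertex
    comes after [i], so [i] lies in a block not above [s] and the factors counted at [s] are
    unchanged. *)
Lemma perverse_degree_del_first c i s :
  is_cell sigma c -> is_cell sigma (del c (inl i)) ->
  {in c.1, forall j : 'I_k.+1, (i <= j)%N} ->
  perverse_degree sigma (del c (inl i)) s = perverse_degree sigma c s.
Proof.
move=> cC iC i_min; rewrite /perverse_degree /=; case: eqP => // _.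
case: ifP => // /andP[/mem_blocks[l sE] sN]; congr EFin; congr Posz.
apply: eq_bigr => u su; rewrite /factor_dim /=; congr (_ + _).-1.
apply: eq_card => j; rewrite !inE; case: eqVneq => //= ->; apply/esym/negbTE.
apply/negP => /andP[iF /eqP iu]; have /and3P[_ _ /forallP/(_ l)] := iC.
rewrite -sE (negbTE sN) /= => /set0Pn[j' ]; rewrite !inE => /andP[/andP[_ /i_min]].
by move=> /(chain_le sigma) + /eqP j's; rewrite j's iu (lt_geF su).
Qed.

Lemma allowable_cut (w : cochain P R k) :
  allowable sigma p w -> allowable sigma p (cut t w).
Proof.
move=> /allowableP H; apply/allowableP => c s cC /cut_neq0[_].
exact: H.
Qed.

Lemma allowable_coboundary_cut (w : cochain P R k) :
  (forall c, w c != 0 -> is_cell sigma c) ->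
  allowable sigma p w -> allowable sigma p (coboundary sigma w) ->
  allowable sigma p (coboundary sigma (cut t w)).
Proof.
move=> wC /allowableP wp /allowableP dwp; apply/allowableP => c s cC dc.
(* If [t] is 1 on all of [F], it is 1 on every face, and the coboundaries of [cut t w] and [w] agree
   at [c]. *)
have [/forall_inP t1|t1] := boolP [forall i in c.1, t i == ord_max].
  apply: dwp => //; apply: contraNneq dc => <-.
  rewrite !coboundaryE //; apply/eqP; apply: eq_bigr => z _; congr (_ * _).
  rewrite /cut ifT //; apply/forall_inP => i iz; apply: t1.
  by case: z iz => [l|u] //=; rewrite inE => /andP[].
have [_ [z zc /cut_neq0[tz wz]]] := coboundary_neq0 dc.
(* Deleting an apex leaves [F] unchanged, so the deleted item is a vertex. It is the only one in [F]
   where [t] is not 1, hence the first by monotonicity. *)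
case: z zc tz wz => [i|u] zc tz wz; last first.
  by case/negP: t1; apply/forall_inP => i /tz ->.
rewrite -(@perverse_degree_del_first _ i) //; try exact: wC.
  by apply: wp; first exact: wC.
have ti : t i != ord_max.
  apply: contra t1 => /eqP ti; apply/forall_inP => j jF.
  by have [->|ji] := eqVneq j i; rewrite ?ti // tz // !inE ji.
move=> j jF; have [->//|ji] := eqVneq j i; rewrite leqNgt.
apply: contra ti => /ltnW/(chain_le t); rewrite tz ?inE ?ji // => le_ti.
by rewrite eq_le le_ti andbT leEord -ltnS ltn_ord.
Qed.

Lemma blownup_cut n (w : cochain P R k) :
  blownup sigma p n w -> blownup sigma p n (cut t w).
Proof.
move=> wB; have [wn wp dwp] := wB; split.
- by move=> c /cut_neq0[_ /wn].
- exact: allowable_cut.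
- by apply: allowable_coboundary_cut => //; apply: blownup_supp wB.
Qed.

End Blownup.
End Cut.

(** * Doubling a vertex *)

Section MonotoneChain.
Variables (d : Order.disp_t) (T : porderType d) (k : nat) (f : 'I_k.+1 -> T).
Hypothesis f_mono : forall i j : 'I_k.+1, (i <= j)%N -> (f i <= f j)%O.

Fact mono_chain_subproof :
  [forall i : 'I_k.+1, forall j : 'I_k.+1, (i <= j)%N ==>
     ([ffun l => f l] i <= [ffun l => f l] j)%O].
Proof.
apply/forallP => i; apply/forallP => j; apply/implyP; rewrite !ffunE.
exact: f_mono.
Qed.

Definition mono_chain : chain T k := exist _ [ffun l => f l] mono_chain_subproof.

Lemma mono_chainE i : mono_chain i = f i.
Proof. by rewrite /mono_chain /chain_fun /= ffunE. Qed.

End MonotoneChain.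

Lemma simplex_map_ext j k (a b : simplex_map j k) :
  (forall i, a i = b i :> nat) -> a = b.
Proof. by move=> ab; apply: chain_ext => i; apply/val_inj/ab. Qed.

Lemma simplex_map_le j k (a : simplex_map j k) (x y : 'I_j.+1) :
  (x <= y)%N -> (a x <= a y)%N.
Proof. exact: (chain_le a). Qed.

Fact coface_subproof k (h : 'I_k.+2) (i j : 'I_k.+1) :
  (i <= j)%N -> (lift h i <= lift h j)%O.
Proof. by rewrite leEord /= leq_bump2. Qed.

Definition coface k (h : 'I_k.+2) : simplex_map k k.+1 :=
  mono_chain (coface_subproof h).

Lemma cofaceE k (h : 'I_k.+2) i : coface h i = lift h i.
Proof. exact: mono_chainE. Qed.

Fact codeg_bound k (x : 'I_k.+1) (i : 'I_k.+2) : (unbump x i < k.+1)%N.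
Proof. by rewrite /unbump; have := ltn_ord x; have := ltn_ord i; lia. Qed.

Fact codeg_subproof k (x : 'I_k.+1) (i j : 'I_k.+2) :
  (i <= j)%N -> (Ordinal (codeg_bound x i) <= Ordinal (codeg_bound x j))%O.
Proof. by rewrite leEord /= /unbump; lia. Qed.

Definition codeg k (x : 'I_k.+1) : simplex_map k.+1 k :=
  mono_chain (codeg_subproof x).

Lemma codegE k (x : 'I_k.+1) i : codeg x i = unbump x i :> nat.
Proof. by rewrite mono_chainE. Qed.

Fact threshold_subproof k h (i j : 'I_k.+1) : (i <= j)%N ->
  ((if (h <= i)%N then ord_max else ord0 : 'I_2) <=
   (if (h <= j)%N then ord_max else ord0))%O.
Proof.
by move=> ij; rewrite leEord; case: (leqP h i) => //= hi; rewrite (leq_trans hi ij).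
Qed.

(** The values of [h] from 0 to [k.+1] give all simplices of [Delta[1]]: [h] is the number of
    vertices sent to 0. *)
Definition threshold k h : simplex_map k 1 := mono_chain (@threshold_subproof k h).

Lemma thresholdE k h i :
  threshold k h i = if (h <= i)%N then ord_max else ord0.
Proof. exact: mono_chainE. Qed.

Fact coprism_bound j k (a : simplex_map j k) (x : 'I_j.+1) (i : 'I_j.+2) :
  ((x < i) + a (codeg x i) < k.+2)%N.
Proof. by have := ltn_ord (a (codeg x i)); lia. Qed.

Fact coprism_subproof j k (a : simplex_map j k) (x : 'I_j.+1) (i i' : 'I_j.+2) :
  (i <= i')%N -> (Ordinal (coprism_bound a x i) <= Ordinal (coprism_bound a x i'))%O.
Proof.
move=> ii'; rewrite leEord /=.
by have := simplex_map_le a (simplex_map_le (codeg x) ii'); lia.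
Qed.

(* The join of the maps induced by a on [0,x] and on [x,j], as a map between   *)
(* the top simplices of index x and a x of the two prisms.                     *)
Definition coprism j k (a : simplex_map j k) (x : 'I_j.+1) : simplex_map j.+1 k.+1 :=
  mono_chain (coprism_subproof a x).

Lemma coprismE j k (a : simplex_map j k) (x : 'I_j.+1) i :
  coprism a x i = ((x < i) + a (codeg x i))%N :> nat.
Proof. by rewrite mono_chainE. Qed.

Section Doubling.
Variables (k : nat) (x : 'I_k.+1).

Definition low : 'I_k.+2 := widen_ord (leqnSn _) x.
Definition high : 'I_k.+2 := lift ord0 x.


Lemma codeg_low i : codeg x (lift low i) = i.
Proof. by apply: val_inj; rewrite /= codegE /= bumpK. Qed.

Lemma codeg_high i : codeg x (lift high i) = i.
Proof. by apply: val_inj; rewrite /= codegE /= /bump /unbump; lia. Qed.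

Lemma codegK_low : chain_comp (codeg x) (coface low) = simplex_id k.
Proof.
by apply: chain_ext => i; rewrite chain_compE simplex_idE cofaceE codeg_low.
Qed.

Lemma codegK_high : chain_comp (codeg x) (coface high) = simplex_id k.
Proof.
by apply: chain_ext => i; rewrite chain_compE simplex_idE cofaceE codeg_high.
Qed.

(** Together with [threshold_high]: consecutive top simplices of the prism share a face, which will
    make the sum telescope. *)
Lemma threshold_low :
  chain_comp (threshold k.+1 x.+1) (coface low) = threshold k x.
Proof.
apply: chain_ext => i; rewrite chain_compE !thresholdE cofaceE /= /bump.
by congr (if _ then _ else _); lia.
Qed.

Lemma threshold_high :
  chain_comp (threshold k.+1 x.+1) (coface high) = threshold k x.+1.
Proof.
apply: chain_ext => i; rewrite chain_compE !thresholdE cofaceE /= /bump.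
by congr (if _ then _ else _); lia.
Qed.

Lemma codeg_eq i l : (codeg x i == l) =
  if l == x then (i == low) || (i == high) else i == lift low l.
Proof.
rewrite -!(inj_eq val_inj) /= codegE /= /unbump /bump /=.
by case: ifP; lia.
Qed.

End Doubling.

(** With [threshold_coprism], this makes the prism decomposition natural in every simplicial map,
    degeneracies included. *)
Lemma codeg_coprism j k (a : simplex_map j k) (x : 'I_j.+1) :
  chain_comp (codeg (a x)) (coprism a x) = chain_comp a (codeg x).
Proof.
apply: simplex_map_ext => i; rewrite !chain_compE codegE coprismE.
have := codegE x i; rewrite {1}/unbump.
have [xi|ix] := ltnP x i => e.
  have : (x <= codeg x i)%N by lia.
  by move=> /(simplex_map_le a); rewrite /unbump; lia.
have : (codeg x i <= x)%N by lia.
by move=> /(simplex_map_le a); rewrite /unbump; lia.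
Qed.

Lemma threshold_coprism j k (a : simplex_map j k) (x : 'I_j.+1) :
  chain_comp (threshold k.+1 (a x).+1) (coprism a x) = threshold j.+1 x.+1.
Proof.
apply: chain_ext => i; rewrite chain_compE !thresholdE coprismE.
have := codegE x i; rewrite {1}/unbump.
move=> e; congr (if _ then _ else _); have [xi|ix] := ltnP x i.
  have : (x <= codeg x i)%N by lia.
  by move=> /(simplex_map_le a); lia.
have : (codeg x i <= x)%N by lia.
by move=> /(simplex_map_le a); lia.
Qed.

(** * Cells over a degenerate simplex: vertices, signs and faces *)

Section DoubleCell.
Variables (R : comPzRingType) (d : Order.disp_t) (P : porderType d) (k : nat).
Variables (sigma : chain P k) (x : 'I_k.+1).
Implicit Types c : cell P k.
Local Notation tau := (chain_comp sigma (codeg x)).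

Lemma item_inl_eq n (i j : 'I_n.+1) :
  (inl i == inl j :> item P n) = (i == j :> nat).
Proof. by []. Qed.

Definition double_cell c : cell P k.+1 := ([set i | codeg x i \in c.1], c.2).

Lemma blocks_codeg : blocks tau = blocks sigma.
Proof.
apply/eqP; rewrite eqEfsubset blocks_sub; apply/fsubsetP => s /mem_blocks[i ->].
by apply/mem_blocks; exists (lift (low x) i); rewrite chain_compE codeg_low.
Qed.

Lemma codeg_max : tau ord_max = sigma ord_max.
Proof.
rewrite chain_compE; congr (sigma _); apply: val_inj.
by rewrite /= codegE /= /unbump; have := ltn_ord x; lia.
Qed.

Lemma mem_block_double c s i :
  (i \in block_face tau (double_cell c) s) = (codeg x i \in block_face sigma c s).
Proof. by rewrite !inE chain_compE. Qed.

Lemma block_double_eq0 c s :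
  (block_face tau (double_cell c) s == set0) = (block_face sigma c s == set0).
Proof.
apply/eqP/eqP => e; apply/setP => i; rewrite in_set0.
  by rewrite -[i](codeg_low x) -mem_block_double e in_set0.
by rewrite mem_block_double e in_set0.
Qed.

Lemma is_cell_double c : is_cell tau (double_cell c) = is_cell sigma c.
Proof.
rewrite /is_cell /regular codeg_max blocks_codeg; congr [&& _, _ & _].
apply/forallP/forallP => H i; last by rewrite block_double_eq0 chain_compE.
by have := H (lift (low x) i); rewrite block_double_eq0 chain_compE codeg_low.
Qed.

(** Blocks and apexes are unchanged, and no factor loses a vertex. *)
Lemma perverse_degree_double c s :
  (perverse_degree sigma c s <= perverse_degree tau (double_cell c) s)%O.
Proof.
rewrite /perverse_degree codeg_max blocks_codeg; case: eqP => //= _.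
case: ifP => // _; rewrite lee_fin lez_nat; apply: leq_sum => t _.
rewrite /factor_dim /=; rewrite -!subn1 leq_sub2r // leq_add2r.
rewrite -(card_imset _ (@lift_inj _ (low x))); apply: subset_leq_card.
by apply/subsetP => _ /imsetP[i ic ->]; rewrite mem_block_double codeg_low.
Qed.

Definition lift_item (z : item P k) : item P k.+1 :=
  match z with inl i => inl (lift (low x) i) | inr s => inr s end.

Lemma items_double c : x \in c.1 ->
  perm_eq (items (double_cell c))
    [:: inl (low x), inl (high x)
      & [seq lift_item z | z <- items c & z != inl x]].
Proof.
move=> xc; have up_inj : injective lift_item.
  move=> [i|s] [j|t] //=; last by move=> [->].
  move=> /(congr1 (fun z => if z is inl l then codeg x l else x)).
  by rewrite !codeg_low => ->.
have lowE z : z != inl x -> (lift_item z != inl (low x)) && (lift_item z != inl (high x)).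
  case: z => //= i; rewrite !item_inl_eq /= /bump.
  by lia.
apply: uniq_perm; first exact: uniq_items.
  rewrite /= map_inj_uniq // filter_uniq ?uniq_items // andbT !inE negb_or.
  rewrite item_inl_eq /=.
  apply/andP; split; last first.
    apply/negP => /mapP[z]; rewrite mem_filter => /andP[/lowE/andP[_ /eqP h] _].
    by move=> e; apply: h.
  apply/andP; split; first by rewrite /bump; lia.
  apply/negP => /mapP[z]; rewrite mem_filter => /andP[/lowE/andP[/eqP h _] _].
  by move=> e; apply: h.
move=> [j|s]; rewrite mem_items !inE.
  rewrite -![inl _ == inl _]/(_ == _) orbA.
  have [jx|jx] := boolP ((j == low x) || (j == high x)).
    by have := codeg_eq x j x; rewrite eqxx jx => /eqP ->.
  have e : j = lift (low x) (codeg x j).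
    apply/eqP; have := codeg_eq x j (codeg x j); rewrite eqxx.
    case: eqP => // jE; have := codeg_eq x j x; by rewrite eqxx jE eqxx (negbTE jx).
  have jN : codeg x j != x.
    by apply: contraNneq jx => jE; have := codeg_eq x j x; rewrite !eqxx jE eqxx => <-.
  apply/idP/mapP => [jc|[z]].
    exists (inl (codeg x j)); last by rewrite /= -e.
    by rewrite mem_filter mem_items jc andbT.
  rewrite mem_filter mem_items => /andP[_]; case: z => //= i ic.
  by move=> [->]; rewrite codeg_low.
apply/idP/mapP => [sc|[z]].
  by exists (inr s); rewrite // mem_filter mem_items sc.
by rewrite mem_filter mem_items => /andP[_]; case: z => //= t tc [->].
Qed.

Lemma before_lift z z' :
  before tau (lift_item z) (lift_item z') = before sigma z z'.
Proof.
case: z z' => [i|s] [j|t] //=; rewrite ?chain_compE ?codeg_low //.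
by rewrite !ltnNge leq_bump2.
Qed.

Lemma before_lift_low z : z != inl x ->
  before tau (lift_item z) (inl (low x)) = before sigma z (inl x) /\
  before tau (inl (low x)) (lift_item z) = before sigma (inl x) z.
Proof.
case: z => [i|s] /=; last first.
  by rewrite chain_compE -[low x](_ : lift (high x) x = _) ?codeg_high //;
     apply: ord_inj; rewrite /= /bump; lia.
by rewrite item_inl_eq /= /bump; split; lia.
Qed.

Lemma before_lift_high z : z != inl x ->
  before tau (lift_item z) (inl (high x)) = before sigma z (inl x) /\
  before tau (inl (high x)) (lift_item z) = before sigma (inl x) z.
Proof.
case: z => [i|s] /=; last first.
  by rewrite chain_compE -[high x](_ : lift (low x) x = _) ?codeg_low //;
     apply: ord_inj; rewrite /= /bump; lia.
by rewrite item_inl_eq /= /bump; split; lia.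
Qed.

Lemma rankD1 c z : x \in c.1 ->
  rank sigma c z = (before sigma (inl x) z +
    count (before sigma ^~ z) [seq y <- items c | y != inl x])%N.
Proof.
move=> xc; have xI : inl x \in items c by rewrite mem_items.
by rewrite (rank_del _ _ xI) /rank (permP (items_delE xI)).
Qed.

(** Exactly the items after [x] see one more item before them. *)
Lemma rank_double_lift c z : x \in c.1 -> z != inl x ->
  rank tau (double_cell c) (lift_item z) = (rank sigma c z + before sigma (inl x) z)%N.
Proof.
move=> xc zx; rewrite (rankD1 z xc) /rank (permP (items_double xc)).
rewrite [LHS](_ : _ = before tau (inl (low x)) (lift_item z) +
  (before tau (inl (high x)) (lift_item z) + count (before tau ^~ (lift_item z))
     [seq lift_item y | y <- items c & y != inl x]))%N //.
have [_ ->] := before_lift_low zx; have [_ ->] := before_lift_high zx.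
rewrite count_map -addnA; congr (_ + _)%N; rewrite addnC; congr (_ + _)%N.
by apply: eq_count => y; rewrite /= before_lift.
Qed.

Lemma rank_double_low c : x \in c.1 ->
  rank tau (double_cell c) (inl (low x)) = rank sigma c (inl x).
Proof.
move=> xc; rewrite (rankD1 _ xc) /rank (permP (items_double xc)) /=.
rewrite !ltnn ltnNge leqW //= count_map; apply: eq_in_count => y.
by rewrite mem_filter => /andP[/before_lift_low[<- _] _].
Qed.

Lemma rank_double_high c : x \in c.1 ->
  rank tau (double_cell c) (inl (high x)) = (rank sigma c (inl x)).+1.
Proof.
move=> xc; rewrite (rankD1 _ xc) /rank (permP (items_double xc)) /=.
rewrite /bump add1n !ltnn ltnSn /= count_map; congr _.+1; apply: eq_in_count => y.
by rewrite mem_filter => /andP[/before_lift_high[<- _] _].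
Qed.

Lemma size_items_double c : x \in c.1 ->
  size (items (double_cell c)) = (size (items c)).+1.
Proof.
move=> xc; have xI : inl x \in items c by rewrite mem_items.
rewrite (perm_size (items_double xc)) (perm_size (items_del xI)) /= size_map.
by rewrite (perm_size (items_delE xI)).
Qed.

Lemma block_sign_double s : block_sign R tau s = block_sign R sigma s.
Proof. by rewrite /block_sign blocks_codeg. Qed.

(** The lower copy has the rank of [x] and the upper copy one more; hence the opposite signs here
    and in [item_sign_high]. *)
Lemma item_sign_low c : x \in c.1 ->
  item_sign R sigma c (inl x) * item_sign R tau (double_cell c) (inl (low x)) = 1.
Proof.
move=> xc; rewrite /item_sign rank_double_low // block_sign_double.
rewrite [item_block tau _](_ : _ = sigma x); last first.
  by rewrite /= chain_compE (eqP (_ : codeg x (low x) == x)) // codeg_eq !eqxx.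
by rewrite mulrACA -!expr2 /block_sign !sqrr_sign mulr1.
Qed.

Lemma item_sign_high c : x \in c.1 ->
  item_sign R sigma c (inl x) * item_sign R tau (double_cell c) (inl (high x)) = -1.
Proof.
move=> xc; rewrite /item_sign rank_double_high // block_sign_double.
rewrite [item_block tau _](_ : _ = sigma x); last first.
  by rewrite /= chain_compE (eqP (_ : codeg x (high x) == x)) // codeg_eq !eqxx orbT.
by rewrite mulrACA exprS mulN1r mulrN mulrN -!expr2 /block_sign !sqrr_sign mulr1.
Qed.

Lemma item_sign_lift c z : x \in c.1 -> z != inl x ->
  item_sign R tau (double_cell c) (lift_item z) =
  block_sign R sigma (item_block sigma z) *
    (-1) ^+ (rank sigma c z + before sigma (inl x) z).
Proof.
move=> xc zx; rewrite /item_sign rank_double_lift // block_sign_double.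
by case: z {zx} => //= i; rewrite chain_compE codeg_low.
Qed.

Lemma del_double_lift c z : z != inl x ->
  del (double_cell c) (lift_item z) = double_cell (del c z).
Proof.
case: z => //= l lx; congr pair; apply/setP => i; rewrite !inE codeg_eq.
by rewrite -[l == x]/(inl l == inl x :> item P k) (negbTE lx).
Qed.

Lemma del_double_low c :
  del (double_cell c) (inl (low x)) = (coface (low x) @: c.1, c.2).
Proof.
congr pair; apply/setP => i; rewrite !inE.
apply/andP/imsetP => [[il ic]|[l lc ->]]; last first.
  by rewrite cofaceE codeg_low lc eq_sym neq_lift.
case: (unliftP (low x) i) il ic => [l -> _|->]; last by rewrite eqxx.
by rewrite codeg_low => lc; exists l; rewrite ?cofaceE.
Qed.

Lemma del_double_high c :
  del (double_cell c) (inl (high x)) = (coface (high x) @: c.1, c.2).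
Proof.
congr pair; apply/setP => i; rewrite !inE.
apply/andP/imsetP => [[il ic]|[l lc ->]]; last first.
  by rewrite cofaceE codeg_high lc eq_sym neq_lift.
case: (unliftP (high x) i) il ic => [l -> _|->]; last by rewrite eqxx.
by rewrite codeg_high => lc; exists l; rewrite ?cofaceE.
Qed.

(** Neither copy of [x] lies in the cell, so both deletions do nothing. This will let the
    telescoping sum run over vertices outside [F]. *)
Lemma del_double_out c : x \notin c.1 ->
  del (double_cell c) (inl (low x)) = del (double_cell c) (inl (high x)).
Proof.
move=> /negbTE xc; congr pair; apply/setP => i; rewrite !inE.
have [->|il] := eqVneq i (low x).
  by rewrite (eqP (_ : codeg x (low x) == x)) ?xc ?andbF // codeg_eq !eqxx.
have [->|//] := eqVneq i (high x).
by rewrite (eqP (_ : codeg x (high x) == x)) ?xc ?andbF // codeg_eq !eqxx orbT.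
Qed.

End DoubleCell.

(** * Homotopy invariance *)

Section CoprismCell.
Variables (d : Order.disp_t) (P : porderType d) (j k : nat).
Variables (sigma : chain P k) (a : simplex_map j k) (x : 'I_j.+1) (c : cell P j).
Hypothesis xc : x \in c.1.

Lemma coprism_inj : {in c.1 &, injective a} ->
  {in (double_cell x c).1 &, injective (coprism a x)}.
Proof.
move=> ca i i'; rewrite !inE => ic i'c e.
have es : codeg x i = codeg x i'.
  apply: ca => //; rewrite -!chain_compE -codeg_coprism !chain_compE.
  by rewrite e.
have := congr1 val e; have := congr1 val es; rewrite /= !coprismE !codegE es.
by rewrite /unbump => *; apply: ord_inj; lia.
Qed.

(** Guarantees that the doubled cells over a degenerate image are degenerate too, so that both sides
    of [prism_act] vanish together. *)
Lemma coprism_inj_inv : {in (double_cell x c).1 &, injective (coprism a x)} ->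
  {in c.1 &, injective a}.
Proof.
move=> ci; have low_inj (u v : 'I_j.+1) : (u <= x)%N -> (v <= x)%N -> u \in c.1 -> v \in c.1 ->
    a u = a v -> u = v.
  move=> ux vx uc vc e; rewrite -(codeg_high x u) -(codeg_high x v).
  congr (codeg x _); apply: ci; rewrite ?inE ?codeg_high //; apply: ord_inj.
  by rewrite !coprismE !codeg_high e /= /bump; lia.
have high_inj (u v : 'I_j.+1) : (x <= u)%N -> (x <= v)%N -> u \in c.1 -> v \in c.1 ->
    a u = a v -> u = v.
  move=> ux vx uc vc e; rewrite -(codeg_low x u) -(codeg_low x v).
  congr (codeg x _); apply: ci; rewrite ?inE ?codeg_low //; apply: ord_inj.
  by rewrite !coprismE !codeg_low e /= /bump; lia.
move=> u v; wlog uv : u v / (u <= v)%N => [H|uc vc e].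
  by case: (leqP u v) => [/H//|/ltnW/H {}H uc vc e]; apply/esym/H.
have [vx|xv] := leqP v x; first by apply: low_inj => //; exact: leq_trans vx.
have [xu|/ltnW ux] := leqP x u; first by apply: high_inj => //; exact: ltnW.
have ex : a u = a x.
  have h1 := simplex_map_le a ux; have h2 := simplex_map_le a (ltnW xv).
  by apply: ord_inj; move: (congr1 val e) => /=; lia.
(* Here [u] and [v] lie on either side of [x]; monotonicity gives [a x] the same value, and since
   [x] is in [F] each side can be compared with it. *)
rewrite (low_inj u x) //; apply: high_inj => //; [exact: ltnW|by rewrite -ex].
Qed.

Lemma push_cell_double : {in c.1 &, injective a} ->
  push_cell (chain_comp sigma (codeg (a x))) (coprism a x) (double_cell x c) =
  double_cell (a x) (push_cell sigma a c).
Proof.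
move=> ca; rewrite /push_cell /double_cell /=.
rewrite -chain_compA codeg_coprism chain_compA !blocks_codeg; congr pair.
apply/setP => I; rewrite inE; apply/imsetP/imsetP => [[i]|[l lc e]].
  rewrite inE => ic ->; exists (codeg x i) => //.
  by rewrite -!chain_compE codeg_coprism.
have eI := congr1 val e; rewrite /= codegE /unbump in eI.
(* The side of [a x] on which [I] lies decides which copy of [l] is its preimage; injectivity on [F]
   puts [l] on the matching side of [x]. *)
have [Ix|xI] := leqP I (a x).
  have lx : (l <= x)%N.
    rewrite leqNgt; apply/negP => xl.
    have := simplex_map_le a (ltnW xl) => h.
    have : a l = a x by apply: ord_inj; lia.
    by move=> /ca el; move: xl; rewrite el ?ltnn.
  exists (lift (high x) l); first by rewrite inE codeg_high.
  by apply: ord_inj; rewrite coprismE codeg_high /= /bump; lia.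
have lx : (x <= l)%N.
  rewrite leqNgt; apply/negP => xl.
  have := simplex_map_le a (ltnW xl) => h.
  have : a l = a x by apply: ord_inj; lia.
  by move=> /ca el; move: xl; rewrite el ?ltnn.
exists (lift (low x) l); first by rewrite inE codeg_low.
by apply: ord_inj; rewrite coprismE codeg_low /= /bump; lia.
Qed.

End CoprismCell.

(** * The cylinder over N(P) and its two ends *)

Section Cylinder.
Variables (d : Order.disp_t) (P : porderType d) (L : ssetP P).

Definition cyl_obj k : Type := (L k * simplex_map k 1)%type.

Definition cyl_act j k (a : simplex_map j k) (x : cyl_obj k) : cyl_obj j :=
  (sset_act L a x.1, chain_comp x.2 a).

Fact cyl_act1 k (x : cyl_obj k) : cyl_act (simplex_id k) x = x.
Proof. by case: x => y t; rewrite /cyl_act sset_act1 chain_compx1. Qed.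

Fact cyl_actM i j k (a : simplex_map j k) (b : simplex_map i j) (x : cyl_obj k) :
  cyl_act (chain_comp a b) x = cyl_act b (cyl_act a x).
Proof. by rewrite /cyl_act sset_actM chain_compA. Qed.

Definition cyl_sset : sset := Sset cyl_act1 cyl_actM.

Fact cyl_proj_subproof j k (a : simplex_map j k) (x : cyl_sset k) :
  supp (sset_act cyl_sset a x).1 = sset_act (nerve P) a (supp x.1).
Proof. exact: supp_act. Qed.

Definition cyl : ssetP P :=
  SsetP (@SsetMap cyl_sset (nerve P) (fun k x => supp x.1) cyl_proj_subproof).

Fact cyl_fst_subproof j k (a : simplex_map j k) (x : cyl k) :
  (sset_act cyl a x).1 = sset_act L a x.1.
Proof. by []. Qed.

Definition cyl_fst : ssetP_map cyl L :=
  @SsetPMap _ _ cyl L (@SsetMap cyl L (fun k x => x.1) cyl_fst_subproof)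
    (fun k x => erefl).

Lemma comp_threshold_const b j k (a : simplex_map j k) :
  chain_comp (threshold k (if b then 0 else k.+1)) a =
  threshold j (if b then 0 else j.+1).
Proof.
apply: chain_ext => i; rewrite chain_compE !thresholdE.
by case: b; rewrite ?leq0n // !ifN // -ltnNge ltn_ord.
Qed.

Fact cyl_end_subproof (b : bool) j k (a : simplex_map j k) (y : L k) :
  (sset_act L a y, threshold j (if b then 0 else j.+1)) =
  sset_act cyl a (y, threshold k (if b then 0 else k.+1)).
Proof. by rewrite /= /cyl_act /= comp_threshold_const. Qed.

(* The end L * {b}: threshold k 0 is constant at 1, threshold k k.+1 at 0.     *)
Definition cyl_end (b : bool) : ssetP_map L cyl :=
  @SsetPMap _ _ L cyl (@SsetMap L cyl
      (fun k y => (y, threshold k (if b then 0 else k.+1))) (cyl_end_subproof b))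
    (fun k x => erefl).

End Cylinder.

(** * The prism operator and its homotopy identity *)

Section Prism.
Variables (R : comPzRingType) (d : Order.disp_t) (P : porderType d) (L : ssetP P).

Definition prism_simplex k (y : L k) (x : 'I_k.+1) : cyl L k.+1 :=
  (sset_act L (codeg x) y, threshold k.+1 x.+1).

(** The transpose of the prism decomposition. Only vertices of [F] are doubled: an apex has no
    coordinate in [Delta[1]]. *)
Definition prism (w : cofamily R (cyl L)) : cofamily R L := fun k y c =>
  if is_cell (supp y) c then
    \sum_(x in c.1) vertex_sign R (supp y) c x * w k.+1 (prism_simplex y x) (double_cell x c)
  else 0.

Lemma supp_prism k (y : L k) x :
  supp (prism_simplex y x) = chain_comp (supp y) (codeg x).
Proof. exact: supp_act. Qed.

Lemma prism_simplex_act j k (a : simplex_map j k) (y : L k) x :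
  prism_simplex (sset_act L a y) x =
  sset_act (cyl L) (coprism a x) (prism_simplex y (a x)).
Proof.
rewrite /prism_simplex /= /cyl_act /= -!sset_actM codeg_coprism.
by rewrite threshold_coprism.
Qed.

Lemma prism_low k (y : L k) (x : 'I_k.+1) :
  sset_act (cyl L) (coface (low x)) (prism_simplex y x) = (y, threshold k x).
Proof.
by rewrite /= /cyl_act /= -sset_actM codegK_low sset_act1 threshold_low.
Qed.

Lemma prism_high k (y : L k) (x : 'I_k.+1) :
  sset_act (cyl L) (coface (high x)) (prism_simplex y x) = (y, threshold k x.+1).
Proof.
by rewrite /= /cyl_act /= -sset_actM codegK_high sset_act1 threshold_high.
Qed.

Variables (q : perversity P) (n : int) (w : cofamily R (cyl L)).
Hypothesis wB : w \in blownup_family q (L := cyl L) n.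

Let w_blownup k (x : cyl L k) : blownup (supp x) q n (w x).
Proof. by have /asboolP[] := wB. Qed.

Let w_act j k (a : simplex_map j k) (x : cyl L k) :
  w (sset_act (cyl L) a x) = pull (supp x) a (w x).
Proof. by have /asboolP[_] := wB. Qed.

Let w_cell k (x : cyl L k) c : w x c != 0 -> is_cell (supp x) c.
Proof. exact: blownup_supp (w_blownup x) c. Qed.

Let w_double_cell k (y : L k) x c :
  w (prism_simplex y x) (double_cell x c) != 0 -> is_cell (supp y) c.
Proof. by move=> /w_cell; rewrite supp_prism is_cell_double. Qed.

Lemma prism_neq0 k (y : L k) c : prism w y c != 0 ->
  is_cell (supp y) c /\ exists2 x, x \in c.1 & w (prism_simplex y x) (double_cell x c) != 0.
Proof.
rewrite /prism; case: ifP; last by rewrite eqxx.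
move=> cC pc; split=> //; apply/exists_inP; apply: contraNT pc.
move=> /exists_inPn H; rewrite big1 // => x /H/negPn/eqP ->.
by rewrite mulr0.
Qed.

Lemma homogeneous_prism k (y : L k) : homogeneous (supp y) (n - 1) (prism w y).
Proof.
move=> c /prism_neq0[cC [x xc wx]]; split=> //.
have [+ _ _] := w_blownup (prism_simplex y x).
move=> /(_ _ wx)[dC <-]; rewrite supp_prism in dC *.
apply: (addrI (size (blocks (supp y)))%:Z).
rewrite addrA -{2}(blocks_codeg (supp y) x) -!PoszD.
rewrite ![(size (blocks _) + _)%N]addnC !cell_dim_items // size_items_double //.
by rewrite -addn1 PoszD addrK.
Qed.

Lemma allowable_prism k (y : L k) : allowable (supp y) q (prism w y).
Proof.
apply/allowableP => c s cC /prism_neq0[_ [x xc wx]].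
apply: le_trans (perverse_degree_double _ x c s) _; rewrite -supp_prism.
have [_ /allowableP H _] := w_blownup (prism_simplex y x).
by apply: H => //; apply: w_cell.
Qed.

Lemma family_low k (y : L k) (x : 'I_k.+1) c : is_cell (supp y) c ->
  w (y, threshold k x) c = w (prism_simplex y x) (del (double_cell x c) (inl (low x))).
Proof.
move=> cC; rewrite -prism_low w_act supp_prism pullE.
- rewrite del_double_low /push_cell -chain_compA codegK_low chain_compx1.
  by rewrite blocks_codeg fsetDv fsetU0.
- by rewrite -chain_compA codegK_low chain_compx1.
- by move=> i i' _ _; rewrite !cofaceE => /lift_inj.
Qed.

Lemma family_high k (y : L k) (x : 'I_k.+1) c : is_cell (supp y) c ->
  w (y, threshold k x.+1) c =
  w (prism_simplex y x) (del (double_cell x c) (inl (high x))).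
Proof.
move=> cC; rewrite -prism_high w_act supp_prism pullE.
- rewrite del_double_high /push_cell -chain_compA codegK_high chain_compx1.
  by rewrite blocks_codeg fsetDv fsetU0.
- by rewrite -chain_compA codegK_high chain_compx1.
- by move=> i i' _ _; rewrite !cofaceE => /lift_inj.
Qed.

Lemma prism_act j k (a : simplex_map j k) (y : L k) :
  prism w (sset_act L a y) = pull (supp y) a (prism w y).
Proof.
apply/funext => c; rewrite /prism supp_act /pull.
have [cC|//] /= := boolP (is_cell (chain_comp (supp y) a) c).
have wE x : w (prism_simplex (sset_act L a y) x) =
    pull (chain_comp (supp y) (codeg (a x))) (coprism a x)
      (w (prism_simplex y (a x))).
  by rewrite prism_simplex_act w_act supp_prism.
case: dinjectiveP => [ca|caN]; last first.
  rewrite big1 // => x xc; rewrite wE pull_eq0 ?mulr0 //.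
  by move=> /(coprism_inj_inv xc).
rewrite push_cellP // big_imset //=; apply: eq_bigr => x xc.
rewrite vertex_sign_push //; congr (_ * _); rewrite wE pullE.
- by rewrite push_cell_double.
- by rewrite -chain_compA codeg_coprism chain_compA is_cell_double.
- exact: coprism_inj.
Qed.

Section Identity.
Variables (k : nat) (y : L k) (c : cell P k).
Hypothesis cC : is_cell (supp y) c.
Local Notation sigma := (supp y).

(** The contribution of deleting [z] and doubling [x]; it occurs with opposite signs in the two
    composites of [prism] and the coboundary. *)
Let term x z := block_sign R sigma (item_block sigma z) *
  block_sign R sigma (sigma x) *
  (-1) ^+ (rank sigma c z + rank sigma c (inl x) + before sigma z (inl x)) *
  w (prism_simplex y x) (double_cell x (del c z)).

Lemma coboundary_prismE : coboundary sigma (prism w y) c =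
  \sum_(x in c.1) \sum_(z <- items c | z != inl x) term x z.
Proof.
rewrite coboundaryE // (exchange_big_dep predT) //=; apply: eq_big_seq => z zc.
have delE x : (x \in (del c z).1) = (x \in c.1) && (z != inl x).
  case: z {zc} => [i|s] /=; last by rewrite andbT.
  by rewrite in_setD1 andbC eq_sym.
rewrite /prism; case: ifP => [zC|/negP zN]; last first.
  rewrite mulr0 big1 // => x _; rewrite /term [w _ _](_ : _ = 0) ?mulr0 //.
  by apply/eqP/negPn/negP => /w_double_cell.
rewrite mulr_sumr; apply: eq_big => [x|x]; first exact: delE.
rewrite delE => /andP[xc zx]; rewrite vertex_signE // mulrA /item_sign mulrACA.
rewrite /term (rank_del _ (inl x) zc); congr (_ * _ * _); case: before => /=.
  by rewrite addn1 add1n addnS !exprS exprD !mulN1r opprK.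
by rewrite addn0 exprD.
Qed.

Lemma prism_deltaE : prism (delta w) y c =
  \sum_(x in c.1) (w (y, threshold k x) c - w (y, threshold k x.+1) c -
    \sum_(z <- items c | z != inl x) term x z).
Proof.
rewrite /prism cC; apply: eq_bigr => x xc; rewrite vertex_signE //.
rewrite /delta supp_prism coboundaryE ?is_cell_double //.
rewrite (perm_big _ (items_double xc)) !big_cons big_map big_filter.
rewrite -[block_sign _ _ _ * _]/(item_sign R sigma c (inl x)) !mulrDr.
have lowE v : item_sign R sigma c (inl x) *
    (item_sign R (chain_comp sigma (codeg x)) (double_cell x c) (inl (low x)) * v) = v.
  by rewrite mulrA item_sign_low // mul1r.
have highE v : item_sign R sigma c (inl x) *
    (item_sign R (chain_comp sigma (codeg x)) (double_cell x c) (inl (high x)) * v) = - v.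
  by rewrite mulrA item_sign_high // mulN1r.
rewrite lowE highE -family_low // -family_high // addrA.
congr (_ + _); rewrite mulr_sumr -sumrN big_seq_cond [RHS]big_seq_cond.
apply: eq_bigr => z /andP[zc zx]; have xI : inl x \in items c by rewrite mem_items.
rewrite item_sign_lift // del_double_lift // mulrA /item_sign mulrACA -mulNr.
(* Exactly one of [z] and [x] precedes the other, which is the source of the minus sign. *)
rewrite (beforeN cC zc xI zx) [block_sign _ _ _ * _]mulrC -mulrN; congr (_ * _ * _).
rewrite !exprD; case: before => /=; first by rewrite expr0 expr1 mulr1 mulrN1 opprK mulrC.
by rewrite expr0 expr1 mulr1 mulrN1 mulrN mulrC.
Qed.

Lemma prism_homotopy : coboundary sigma (prism w y) c + prism (delta w) y c =
  w (y, threshold k 0) c - w (y, threshold k k.+1) c.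
Proof.
rewrite coboundary_prismE prism_deltaE -big_split /=.
under eq_bigr do rewrite addrC subrK.
(* For [x] outside [F] the two end terms coincide, so the sum extends to all [x] and telescopes. *)
rewrite big_mkcond /= (eq_bigr (fun x : 'I_k.+1 =>
  w (y, threshold k x) c - w (y, threshold k x.+1) c)); last first.
  move=> x _; case: ifP => // /negbT xc; rewrite family_low // family_high //.
  by rewrite del_double_out // subrr.
rewrite -(big_mkord predT (fun x => w (y, threshold k x) c - w (y, threshold k x.+1) c)).
rewrite -[RHS]opprB -(telescope_sumr (fun x => w (y, threshold k x) c)) // -sumrN.
by apply: eq_bigr => x _; rewrite opprB.
Qed.

End Identity.

Lemma delta_prism : delta w = 0 ->
  delta (prism w) = pullback (cyl_end L true) w - pullback (cyl_end L false) w.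
Proof.
move=> dw; apply: cofam_ext => k y c.
have [cC|cN] := boolP (is_cell (supp y) c).
  rewrite -[RHS](prism_homotopy cC) dw.
  rewrite [X in _ = _ + X](_ : _ = 0) ?addr0 //.
  rewrite /prism cC big1 // => x _; exact: mulr0.
rewrite [LHS](_ : _ = 0); last by rewrite /delta /coboundary (negbTE cN).
have w0 b : pullback (cyl_end L b) w y c = 0.
  by apply/eqP/negPn/negP => /w_cell; apply/negP.
by rewrite -[RHS]/(_ - _) !w0 subrr.
Qed.

(** Allowability of the coboundary is not checked cell by cell: since [w] is closed, [delta_prism]
    makes it a difference of two restrictions of [w]. *)
Lemma prism_family : delta w = 0 -> prism w \in blownup_family q (L := L) (n - 1).
Proof.
move=> dw; apply/asboolP; split=> [k y|j k a y]; last exact: prism_act.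
split; [exact: homogeneous_prism|exact: allowable_prism|].
rewrite -[coboundary _ _]/(delta (prism w) y) delta_prism // addrC -scaleN1r.
have e (b : bool) : blownup (supp y) q n (pullback (cyl_end L b) w y).
  exact: (w_blownup (cyl_end L b k y)).
by have [_ +] := blownup_lin (-1) (e false) (e true).
Qed.

End Prism.

(** * Operations and the Eilenberg-MacLane space *)

Section Cohomology.
Variables (R : comPzRingType) (d : Order.disp_t) (P : porderType d).

Definition ssetP_id (L : ssetP P) : ssetP_map L L :=
  @SsetPMap _ _ L L (@SsetMap L L (fun k x => x) (fun _ _ _ _ => erefl))
    (fun _ _ => erefl).

Section Composition.
Variables (L M N : ssetP P) (g : ssetP_map M N) (f : ssetP_map L M).

Fact ssetP_comp_nat j k (a : simplex_map j k) (x : L k) :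
  g j (f j (sset_act L a x)) = sset_act N a (g k (f k x)).
Proof. by rewrite !smap_nat. Qed.

Fact ssetP_comp_proj k (x : L k) : supp (g k (f k x)) = supp x.
Proof. by rewrite !spmap_proj. Qed.

Definition ssetP_comp : ssetP_map L N :=
  @SsetPMap _ _ L N (@SsetMap L N (fun k x => g k (f k x)) ssetP_comp_nat)
    ssetP_comp_proj.

End Composition.

Section Maps.
Variables (p : perversity P) (n : int).

Lemma eq_cohomology_map L M (f g : ssetP_map L M) (h : cohomology R p M n) :
  (forall k x, f k x = g k x) -> cohomology_map f h = cohomology_map g h.
Proof.
move=> fg; rewrite -(lreprK h) !cohomology_mapE; congr lclass; apply: val_inj.
by apply: cofam_ext => k x c; rewrite /= /pullback fg.
Qed.

Lemma cohomology_map_id L (h : cohomology R p L n) :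
  cohomology_map (ssetP_id L) h = h.
Proof.
rewrite -(lreprK h) cohomology_mapE; congr lclass; exact: val_inj.
Qed.

Lemma cohomology_map_comp L M N (g : ssetP_map M N) (f : ssetP_map L M)
    (h : cohomology R p N n) :
  cohomology_map (ssetP_comp g f) h = cohomology_map f (cohomology_map g h).
Proof.
by rewrite -(lreprK h) !cohomology_mapE; congr lclass; apply: val_inj.
Qed.

(** The prism of a representing cocycle is a primitive of the difference of its two restrictions. *)
Lemma cyl_end_cohomology L (h : cohomology R p (cyl L) n) :
  cohomology_map (cyl_end L true) h = cohomology_map (cyl_end L false) h.
Proof.
rewrite -(lreprK h) !cohomology_mapE; apply/lclass_eq/asboolP.
have /andP[wB /eqP dw] := valP (lrepr h).
exists (prism (val (lrepr h))); first exact: prism_family.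
by rewrite (delta_prism wB dw).
Qed.

Lemma delta_cocycle (M : ssetP P) (u : cofamily R M) :
  u \in blownup_family p (L := M) (n - 1) -> delta u \in cocycle p (L := M) n.
Proof.
move=> /asboolP[uB u_act]; apply/andP; split.
  apply/asboolP; split=> [k x|j k a x].
    by have [] := blownup_coboundary (uB k x).
  by rewrite /delta supp_act u_act pull_coboundary //; apply: blownup_supp (uB k x).
apply/eqP/cofam_ext => k x c; have [_ h] := blownup_coboundary (uB k x).
exact: (congr1 (@^~ c) h).
Qed.

Section Interpolation.
Variables (L : ssetP P) (v : cofamily R L).
Hypothesis vB : v \in blownup_family p (L := L) (n - 1).

Let v_blownup k (x : L k) : blownup (supp x) p (n - 1) (v x).
Proof. by have /asboolP[] := vB. Qed.

Definition cut_family : cofamily R (cyl L) := fun k x => cut x.2 (v x.1).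

Lemma cut_family_blownup : cut_family \in blownup_family p (L := cyl L) (n - 1).
Proof.
apply/asboolP; split=> [k x|j k a x].
  exact/blownup_cut/v_blownup.
have /asboolP[_ v_act] := vB.
by rewrite /cut_family /= v_act -pull_cut.
Qed.

Lemma pullback_cut1 : pullback (cyl_end L true) cut_family = v.
Proof.
apply: cofam_ext => k x c; rewrite /pullback /cut_family cut1 //= => i.
by rewrite thresholdE.
Qed.

Lemma pullback_cut0 : pullback (cyl_end L false) cut_family = 0.
Proof.
apply: cofam_ext => k x c; rewrite /pullback /cut_family.
rewrite (cut0 (blownup_supp (v_blownup x))) // => i.
by rewrite thresholdE leqNgt ltn_ord.
Qed.

End Interpolation.
End Maps.

(** * Classifying maps and the tautological class *)

Section Classify.
Variables (p : perversity P) (n : int).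
Local Notation EM := (EM_space R n p).

Fact classify_subproof (L : ssetP P) (w : cocycles R p L n) k (x : L k) :
  `[< blownup_cocycle (supp x) p n (val w k x) >].
Proof.
have /andP[/asboolP[wB _] /eqP dw] := valP w; apply/asboolP; split=> //.
apply/funext => c; exact: (congr1 (fun u : cofamily R L => u k x c) dw).
Qed.

Definition classify_fun L (w : cocycles R p L n) k (x : L k) : EM k :=
  exist _ (supp x, val w k x) (classify_subproof w x).

Fact classify_nat L (w : cocycles R p L n) j k (a : simplex_map j k) (x : L k) :
  classify_fun w (sset_act L a x) = sset_act EM a (classify_fun w x).
Proof.
apply: val_inj; rewrite /= supp_act; congr pair.
by have /andP[/asboolP[_ ->] _] := valP w.
Qed.

Definition classify L (w : cocycles R p L n) : ssetP_map L EM :=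
  @SsetPMap _ _ L EM (@SsetMap L EM (@classify_fun L w) (classify_nat w))
    (fun k x => erefl).

Definition EM_family : cofamily R EM := fun k x => (val x).2.

Fact EM_family_cocycle : EM_family \in cocycle p (L := EM) n.
Proof.
apply/andP; split.
  by apply/asboolP; split=> // k x; have /asboolP[] := valP x.
apply/eqP/cofam_ext => k x c; have /asboolP[_ h] := valP x.
exact: (congr1 (@^~ c) h).
Qed.

Definition EM_cocycle : cocycles R p EM n := Cocycle EM_family_cocycle.

Definition EM_class : cohomology R p EM n := lclass _ EM_cocycle.

Lemma classify_pullback L (w : cocycles R p L n) :
  cocycle_pullback (classify w) EM_cocycle = w.
Proof. exact: val_inj. Qed.

Lemma classify_class L (h : cohomology R p L n) :
  cohomology_map (classify (lrepr h)) EM_class = h.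
Proof. by rewrite cohomology_mapE classify_pullback lreprK. Qed.

Lemma classify_comp L M (f : ssetP_map L M) (w : cocycles R p M n) k (x : L k) :
  classify w k (f k x) = classify (cocycle_pullback f w) k x.
Proof. by apply: val_inj; rewrite /= spmap_proj. Qed.

Lemma classify_id k (x : EM k) : classify EM_cocycle k x = x.
Proof. by apply: val_inj; case: x => -[]. Qed.

Lemma classify_cohomologous q m L (w w' : cocycles R p L n)
    (h : cohomology R q EM m) :
  lclass (@coboundaries d P R p L n) w = lclass (@coboundaries d P R p L n) w' ->
  cohomology_map (classify w) h = cohomology_map (classify w') h.
Proof.
move=> /lclass_eq/asboolP[v vB ww'].
(* With [w - w' = delta v], this cocycle restricts to [w] at the end 1 and to [w'] at the end 0. *)
pose W : cocycles R p (cyl L) n := cocycle_pullback (cyl_fst L) w' +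
  Cocycle (delta_cocycle (cut_family_blownup vB)).
have WE b : val (cocycle_pullback (cyl_end L b) W) =
  val w' + delta (pullback (cyl_end L b) (cut_family v)) by rewrite pullback_delta.
have W1 : cocycle_pullback (cyl_end L true) W = w.
  by apply: val_inj; rewrite WE pullback_cut1 -ww' addrC subrK.
have W0 : cocycle_pullback (cyl_end L false) W = w'.
  by apply: val_inj; rewrite WE (pullback_cut0 vB) linear0 addr0.
rewrite -W1 -[in RHS]W0.
rewrite -(eq_cohomology_map (f := ssetP_comp (classify W) (cyl_end L true))); last first.
  exact: classify_comp.
rewrite -[RHS](eq_cohomology_map (f := ssetP_comp (classify W) (cyl_end L false))); last first.
  exact: classify_comp.
by rewrite !cohomology_map_comp cyl_end_cohomology.
Qed.

End Classify.

Lemma operation_ext (p : perversity P) n (q : perversity P) m (e e' : operation R p n q m) :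
  (forall L h, e L h = e' L h) -> e = e'.
Proof.
case: e e' => [e eN] [e' e'N] /= ee'.
have E : e = e'.
  by apply/functional_extensionality_dep => L; apply/funext => h.
by case: _ / E e'N {ee'} => e'N; congr Operation; apply: Prop_irrelevance.
Qed.

Section Represented.
Variables (p : perversity P) (n : int) (q : perversity P) (m : int).
Variable c : cohomology R q (EM_space R n p) m.

(** The representative chosen for the pulled-back class is only cohomologous to the pullback of the
    chosen representative, which [classify_cohomologous] absorbs. *)
Fact represented_nat L M (f : ssetP_map L M) (h : cohomology R p M n) :
  cohomology_map (classify (lrepr (cohomology_map f h))) c =
  cohomology_map f (cohomology_map (classify (lrepr h)) c).
Proof.
rewrite -cohomology_map_comp.
rewrite [RHS](eq_cohomology_map (g := classify (cocycle_pullback f (lrepr h)))); last first.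
  exact: classify_comp.
by apply: classify_cohomologous; rewrite lreprK.
Qed.

Definition represented : operation R p n q m := Operation represented_nat.

End Represented.
End Cohomology.

Theorem theorem3 (R : comPzRingType) (d : Order.disp_t) (P : porderType d)
    (p q : perversity P) (n m : int) :
  exists Phi : operation R p n q m -> cohomology R q (EM_space R n p) m,
    [/\ bijective Phi,
        forall e e' : operation R p n q m,
          Phi (operation_add e e') = Phi e + Phi e' &
        forall (r : R) (e : operation R p n q m),
          Phi (operation_scale r e) = r *: Phi e].
Proof.
exists (fun e : operation R p n q m => e _ (EM_class R p n)); split=> //.
exists (@represented R d P p n q m) => [e|c].
  apply: operation_ext => L h /=.
  by rewrite -op_nat classify_class.
(* The chosen representative of [EM_class] need not be [EM_cocycle], but it is cohomologous to it,
   and [EM_cocycle] is classified by the identity. *)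
rewrite /= (classify_cohomologous (w' := EM_cocycle R p n)) ?lreprK //.
rewrite (eq_cohomology_map (g := ssetP_id _)) ?cohomology_map_id //.
exact: classify_id.
Qed.
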